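(* Let $G$ be a planar graph, let $d\ge 1$ be an integer, and let $A\subseteq V(G)$ be a non-empty set of $c\ge 1$ vertices. Then the set $\{\pi_d[v,A]\mid v\in V(G)\}$ of distance-$d$ profiles on $A$ has at most $64c^3(d+2)^7$ distinct elements.
   Context: All graphs are finite, undirected and simple; $\mathrm{dist}_G(u,v)$ denotes the shortest-path distance in $G$ ($+\infty$ if no path exists). For a vertex $v\in V(G)$ and a set $S\subseteq V(G)$, the distance-$d$ profile $\pi_d[v,S]$ is the function $S\to\{0,1,\dots,d,+\infty\}$ that maps each $u\in S$ to $\mathrm{dist}_G(v,u)$ if this distance is at most $d$, and to $+\infty$ otherwise. *)

(* Defs.v *)
From HB Require Import structures.
From mathcomp Require Import all_boot all_order all_algebra.
From mathcomp Require Import all_classical all_reals all_analysis.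

Set Implicit Arguments.
Unset Strict Implicit.
Unset Printing Implicit Defensive.

Import Order.TTheory GRing.Theory Num.Theory.
Import numFieldNormedType.Exports.

(* A finite simple graph is a finType V with a symmetric and irreflexive
   adjacency relation e : rel V. *)

Section Planarity.
Local Open Scope classical_set_scope.
Local Open Scope ring_scope.
Variable R : realType.

Definition is_arc (x y : R * R) (S : set (R * R)) : Prop :=
  exists f : R -> R * R,
    [/\ {within `[0, 1], continuous f}, set_inj `[0, 1] f,
        f 0 = x, f 1 = y & f @` `[0, 1] = S].

(* The undirected edge uv is indexed by the set {u, v}; the values of E on
   sets that are not edges are irrelevant.  The last two conditions together
   say that two distinct edges meet only in common endpoints, i.e. that the
   interior of an edge contains no vertex and no point of another edge. *)
Definition plane_drawing (V : finType) (e : rel V)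
    (pt : V -> R * R) (E : {set V} -> set (R * R)) : Prop :=
  [/\ injective pt,
      forall u v, e u v -> is_arc (pt u) (pt v) (E [set u; v]%SET),
      forall u v w, e u v -> E [set u; v]%SET (pt w) -> w = u \/ w = v &
      forall u v x y, e u v -> e x y -> [set u; v]%SET != [set x; y]%SET ->
        E [set u; v]%SET `&` E [set x; y]%SET `<=` range pt].

Definition planar (V : finType) (e : rel V) : Prop :=
  exists (pt : V -> R * R) (E : {set V} -> set (R * R)),
    plane_drawing e pt E.

End Planarity.

Section Distance.
Local Open Scope nat_scope.
Variables (V : finType) (e : rel V).

Definition has_path (u v : V) (n : nat) : bool :=
  [exists p : n.-tuple V, [&& path e u p, uniq (u :: p) & last u p == v]].

(* None stands for +oo. *)
Definition dist (u v : V) : option nat :=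
  if pselect (exists n, has_path u v n) is left uv then Some (ex_minn uv)
  else None.

(* insub n : option 'I_d.+1 is None exactly when d < n. *)
Definition profile (d : nat) (v : V) (S : {set V}) :
    {ffun {u : V | u \in S} -> option 'I_d.+1} :=
  [ffun u => obind insub (dist v (val u))].

End Distance.

(* Main.v *)
Require Import Defs.
From HB Require Import structures.
From mathcomp Require Import all_boot all_order all_algebra.
From mathcomp Require Import all_classical all_reals all_analysis.
From mathcomp Require Import zify ring lra.

(* The given vertices that are at distance at most 2d from each other are linked by
   geodesics along a spanning forest; this gives a subgraph h with at most (2d+1)c
   vertices and 2dc edges.  A vertex v outside h sees A only through the distances at
   which it first hits h, refined by the sector of the vertex of h (between two
   consecutive edges of h) through which it arrives.  So the profile of v is
   determined by a set of pairs (sector, distance), of which there are O(d^2 c).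
   These sets shatter no four pairs: geodesics from the witnesses of the six
   two-element subsets would form a K4 on the four sectors in which edges without
   common end are disjoint, and the component of h is adjacent to all four sectors,
   so K5 would be drawn in the plane with disjoint independent edges.  The
   Sauer-Shelah-Pajor inequality then gives a bound cubic in d^2 c.

   K5 has no such drawing: replace the edges by nearby rectilinear paths and count
   crossings of independent edges modulo 2.  The parity is a sum of winding terms,
   each of which occurs twice, and of order terms adding up to an odd number. *)

Set Implicit Arguments.
Unset Strict Implicit.
Unset Printing Implicit Defensive.

Import Order.TTheory GRing.Theory Num.Theory.
Import numFieldNormedType.Exports.

(** * Crossing parity of rectilinear paths *)

(** Edges are arbitrary continuous arcs, which may wind around an end infinitely often, so the edges
    at a vertex need have no cyclic order near it. Each edge is therefore cut where it last leaves a
    small disc around its end (a square, for the sup norm), a straight spoke replaces the part cut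
    off, and the angular order of the cut points serves as rotation. Trimmed edges are pairwise
    disjoint compact sets, hence a positive distance apart; this makes finite rectilinear
    approximation possible, and parity then replaces any appeal to the Jordan curve theorem. The
    statement on K5 concerns compact connected sets rather than arcs: an edge may be glued from
    pieces, and the four edges at the fifth vertex may share a whole component of [h]. A pair
    records that the sector is reached within, not at, a given distance. This monotonicity is what
    the exchange argument needs: when two paths meet, the one that gets there sooner can follow the
    other to its end. *)

Section Parity.
Variable K : Type.
Variable lt : K -> K -> bool.
Notation pt := (K * K)%type.
Implicit Types (s t : pt * pt) (z : pt).

Definition generic a b := (lt a b == ~~ lt b a).
Definition gen_pt (y z : pt) := generic y.1 z.1 && generic y.2 z.2.

Definition between a b x := lt a x (+) lt b x.

(* A step goes from [s.1] horizontally, then vertically, to [s.2]. *)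
Definition cross s t :=
  (between s.1.1 s.2.1 t.2.1 && between t.1.2 t.2.2 s.1.2)
  (+) (between t.1.1 t.2.1 s.2.1 && between s.1.2 s.2.2 t.1.2).

(* A horizontal ray from [z] can only cross the vertical part of a step. *)
Definition right_ray t z := lt z.1 t.2.1 && between t.1.2 t.2.2 z.2.
Definition left_ray s z := lt s.2.1 z.1 && between s.1.2 s.2.2 z.2.

Definition gen_step s t :=
  [/\ gen_pt s.1 t.1, gen_pt s.1 t.2, gen_pt s.2 t.1 & gen_pt s.2 t.2].

(** Along the horizontal part of [s] the right ray changes exactly at a crossing with the vertical
    part of [t]; symmetrically for the left ray along [t]. Along the vertical parts both rays change
    by [lt s.2.1 t.2.1] times the parity of the same four height comparisons, and these two changes
    cancel. This is why opposite rays are used for the two steps. *)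
Lemma cross_rays s t : gen_step s t ->
  cross s t = right_ray t s.1 (+) right_ray t s.2
              (+) (left_ray s t.1 (+) left_ray s t.2).
Proof.
case=> /andP[/eqP a1 /eqP b1] /andP[/eqP a2 /eqP b2] /andP[/eqP a3 /eqP b3]
  /andP[/eqP a4 /eqP b4].
rewrite /cross /right_ray /left_ray /between.
rewrite ?b1 ?b2 ?b3 ?b4 ?a1 ?a2 ?a3 ?a4.
by case: (lt t.1.1 s.1.1); case: (lt t.2.1 s.1.1); case: (lt t.1.1 s.2.1);
  case: (lt t.2.1 s.2.1); case: (lt t.1.2 s.1.2); case: (lt t.2.2 s.1.2);
  case: (lt t.1.2 s.2.2); case: (lt t.2.2 s.2.2).
Qed.

Lemma rays_between s z : generic z.1 s.2.1 ->
  right_ray s z (+) left_ray s z = between s.1.2 s.2.2 z.2.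
Proof. by rewrite /right_ray /left_ray => /eqP ->; case: lt; case: between. Qed.

Fixpoint steps z (p : seq pt) :=
  if p is y :: q then (z, y) :: steps y q else [::].

Definition crossing P Q :=
  \big[addb/false]_(s <- P) \big[addb/false]_(t <- Q) cross s t.
Definition right_wind Q z := \big[addb/false]_(t <- Q) right_ray t z.
Definition left_wind P z := \big[addb/false]_(s <- P) left_ray s z.

Lemma telescope (f : pt -> bool) z p :
  \big[addb/false]_(s <- steps z p) (f s.1 (+) f s.2) = f z (+) f (last z p).
Proof.
elim: p z => [|y p IH] z /=; first by rewrite big_nil addbb.
rewrite big_cons IH /=.
by case: (f z); case: (f y); case: (f _).
Qed.

Lemma telescope_between x z p :
  \big[addb/false]_(s <- steps z p) between s.1.2 s.2.2 x =
  between z.2 (last z p).2 x.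
Proof. exact: (telescope (fun y => lt y.2 x)). Qed.

Lemma mem_steps z p s : List.In s (steps z p) ->
  List.In s.1 (z :: p) /\ List.In s.2 (z :: p).
Proof.
elim: p z => [|y p IH] z //= [<-|/IH[h1 h2]] /=; first by auto.
by split; right.
Qed.

Lemma eq_big_In (I : Type) (r : seq I) (F G : I -> bool) :
  (forall i, List.In i r -> F i = G i) ->
  \big[addb/false]_(i <- r) F i = \big[addb/false]_(i <- r) G i.
Proof.
elim: r => [|i r IH] FG; first by rewrite !big_nil.
by rewrite !big_cons FG /=; [rewrite IH // => j ?; apply: FG; right|left].
Qed.

(** Summing [cross_rays] over all pairs of steps, the ray terms telescope along one path and then
    the other, so that only the four endpoints remain. *)
Lemma crossing_paths z p y q :
  (forall a b, List.In a (z :: p) -> List.In b (y :: q) -> gen_pt a b) ->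
  let P := steps z p in let Q := steps y q in
  crossing P Q = right_wind Q z (+) right_wind Q (last z p)
    (+) (left_wind P y (+) left_wind P (last y q)).
Proof.
move=> gen P Q.
pose W z := right_wind Q z; pose B z := left_wind P z.
rewrite -/(W z) -/(W (last z p)) -/(B y) -/(B (last y q)).
rewrite -(telescope W) -(telescope B) /crossing.
transitivity (\big[addb/false]_(s <- P) \big[addb/false]_(t <- Q)
   (right_ray t s.1 (+) right_ray t s.2 (+) (left_ray s t.1 (+) left_ray s t.2))).
  apply: eq_big_In => s /mem_steps[s1 s2]; apply: eq_big_In => t /mem_steps[t1 t2].
  by apply: cross_rays; split; apply: gen.
under eq_bigr do rewrite big_split /=.
rewrite big_split /=; congr (_ (+) _).
  by apply: eq_bigr => s _; rewrite big_split.
rewrite exchange_big /=.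
by apply: eq_bigr => s _; rewrite big_split.
Qed.

Lemma winds_between z p y : (forall a, List.In a (z :: p) -> gen_pt y a) ->
  right_wind (steps z p) y (+) left_wind (steps z p) y
  = between z.2 (last z p).2 y.2.
Proof.
move=> gen; rewrite -telescope_between // -big_split /=.
apply: eq_big_In => s /mem_steps[_ s2]; apply: rays_between.
by have /andP[] := gen _ s2.
Qed.

Definition crossing_free P Q :=
  forall s t, List.In s P -> List.In t Q -> cross s t = false.

Lemma crossing_free0 P Q : crossing_free P Q -> crossing P Q = false.
Proof.
move=> free; rewrite /crossing (@eq_big_In _ _ _ (fun=> false)).
  by rewrite big1_eq.
move=> s sP; rewrite (@eq_big_In _ _ _ (fun=> false)) ?big1_eq // => t tQ.
exact: free.
Qed.

End Parity.

(** * Two independent edges of K5 cross oddly *)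

Section K5Parity.
Variable K : Type.
Variable lt : K -> K -> bool.
Notation pt := (K * K)%type.
Variables (z : nat -> pt) (P : nat -> nat -> seq pt).
Hypothesis P_last : forall i j, (i < j < 5)%N -> last (z i) (P i j) = z j.
Hypothesis P_gen : forall i j k l, (i < j < 5)%N -> (k < l < 5)%N ->
  uniq [:: i; j; k; l] ->
  forall a b, List.In a (z i :: P i j) -> List.In b (z k :: P k l) ->
  gen_pt lt a b.

Let pstep i j := steps (z i) (P i j).

Lemma In_last (T : Type) (x : T) s : List.In (last x s) (x :: s).
Proof. by elim: s x => [|y s IH] x; [left|right; apply: IH]. Qed.

(** Left windings are traded for right windings by [winds_between], which is where the order terms
    [o] come from. Evenness is expressed in [nat] with a witness, so that the instances can be added
    by linear arithmetic. *)
Lemma crossing_even i j k l : (i < j < 5)%N -> (k < l < 5)%N ->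
    uniq [:: i; j; k; l] -> crossing lt (pstep i j) (pstep k l) = false ->
  let R a b c : nat := right_wind lt (pstep a b) (z c) in
  let o a b : nat := lt (z a).2 (z b).2 in
  exists n, (R k l i + R k l j + R i j k + R i j l
             + o i k + o j k + o i l + o j l = 2 * n)%N.
Proof.
move=> ij kl u; have gen := P_gen ij kl u.
move=> e R o; move: e; rewrite (crossing_paths gen) !P_last // => e.
have zi : List.In (z i) (z i :: P i j) by left.
have zj : List.In (z j) (z i :: P i j) by rewrite -(P_last ij); exact: In_last.
have zk : List.In (z k) (z k :: P k l) by left.
have zl : List.In (z l) (z k :: P k l) by rewrite -(P_last kl); exact: In_last.
have sym a b : gen_pt lt a b -> gen_pt lt b a.
  by move=> /andP[/eqP g1 /eqP g2]; rewrite /gen_pt /generic g1 g2 !negbK !eqxx.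
have wk := winds_between (fun a ha => sym _ _ (gen a (z k) ha zk)).
have wl := winds_between (fun a ha => sym _ _ (gen a (z l) ha zl)).
move: wk wl; rewrite P_last // /between.
move=> wk wl.
exists ((R k l i + R k l j + R i j k + R i j l
             + o i k + o j k + o i l + o j l)./2).
rewrite mul2n -[LHS]odd_double_half -[RHS]add0n; congr (_ + _)%N.
rewrite /R /o /pstep !oddD !oddb; move: e wk wl.
case: (right_wind _ _ (z i)); case: (right_wind _ _ (z j));
case: (right_wind _ _ (z k)); case: (right_wind _ _ (z l));
case: (left_wind _ _ (z k)); case: (left_wind _ _ (z l)) => //= _;
by case: (lt _ _); case: (lt _ _) => // _; case: (lt _ _); case: (lt _ _).
Qed.

Lemma K5_crossing : exists i j k l,
  [/\ (i < j < 5)%N, (k < l < 5)%N, uniq [:: i; j; k; l] &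
      crossing lt (pstep i j) (pstep k l)].
Proof.
apply: contrapT => free.
have E i j k l (ij : (i < j < 5)%N) (kl : (k < l < 5)%N) (u : uniq [:: i; j; k; l]) :
    crossing lt (pstep i j) (pstep k l) = false.
  by apply/negbTE/negP => c; apply: free; exists i, j, k, l; split.
pose o a b : nat := lt (z a).2 (z b).2.
pose R a b c : nat := right_wind lt (pstep a b) (z c).
have flip b i j k l : (i < j < 5)%N -> (k < l < 5)%N -> uniq [:: i; j; k; l] ->
    let m := if b then k else l in
    (o j m + o m j = 1)%N.
  move=> ij kl u m; rewrite /o; have /andP[_ /eqP ->] : gen_pt lt (z j) (z m).
    apply: (P_gen ij kl u); rewrite -?(P_last ij); first exact: In_last.
    by rewrite {}/m; case: b; [left|rewrite -(P_last kl); apply: In_last].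
  by case: lt.
have F i j k l : [&& (i < j < 5)%N, (k < l < 5)%N & uniq [:: i; j; k; l]] ->
    exists n, (R k l i + R k l j + R i j k + R i j l
             + o i k + o j k + o i l + o j l = 2 * n)%N.
  by case/and3P=> ij kl u; exact: (crossing_even ij kl u (E i j k l ij kl u)).
have addE (a b c d : nat) : a = b -> c = d -> (a + c = b + d)%N by move=> -> ->.
(* The fifteen pairs of independent edges: three splittings for each of the five sets of four
   vertices, the edge with the least vertex first. *)
have [n0 E0] := F 0 1 2 3 isT. have [n1 E1] := F 0 2 1 3 isT. have [n2 E2] := F 0 3 1 2 isT.
have [n3 E3] := F 0 1 2 4 isT. have [n4 E4] := F 0 2 1 4 isT. have [n5 E5] := F 0 4 1 2 isT.
have [n6 E6] := F 0 1 3 4 isT. have [n7 E7] := F 0 3 1 4 isT. have [n8 E8] := F 0 4 1 3 isT.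
have [n9 E9] := F 0 2 3 4 isT. have [n10 E10] := F 0 3 2 4 isT. have [n11 E11] := F 0 4 2 3 isT.
have [n12 E12] := F 1 2 3 4 isT. have [n13 E13] := F 1 3 2 4 isT. have [n14 E14] := F 1 4 2 3 isT.
have := (addE _ _ _ _ (addE _ _ _ _ (addE _ _ _ _ (addE _ _ _ _ (addE _ _ _ _
  (addE _ _ _ _ (addE _ _ _ _ (addE _ _ _ _ (addE _ _ _ _ (addE _ _ _ _
  (addE _ _ _ _ (addE _ _ _ _ (addE _ _ _ _ (addE _ _ _ _ E0 E1) E2) E3)
  E4) E5) E6) E7) E8) E9) E10) E11) E12) E13) E14).
(* [o 0 b] occurs six times, [o 1 b] four times and [o b 1] twice, all even. For the pairs {2,3},
   {2,4} and {3,4} each direction occurs three times, so they contribute 3 each: 9 in total, which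
   is odd. *)
have := flip true 0 1 2 3 isT isT isT; have := flip true 0 1 3 4 isT isT isT.
have := flip true 0 2 3 4 isT isT isT; have := flip false 0 1 2 4 isT isT isT.
have := flip false 0 2 1 4 isT isT isT; have := flip false 0 3 1 4 isT isT isT.
cbv zeta iota; clear; clearbody o R; lia.
Qed.
End K5Parity.

(** * K5 in the plane *)

Lemma In_rcons (T : Type) (s : seq T) (x y : T) :
  List.In x (rcons s y) -> List.In x s \/ x = y.
Proof.
elim: s => [[->|[]]|z s IH [->|/IH[]]] /=; by [right|left; left|left; right|right].
Qed.

Section PlaneSets.
Variable R : realType.
Local Open Scope classical_set_scope.
Local Open Scope ring_scope.
Notation plane := (R * R)%type.
Implicit Types (S T : set plane) (p q : plane) (d : R).

(** The points reached by [d]-chains inside [S] form a nonempty subset that is both relatively open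
    and relatively closed: it and its complement in [S] are traces of unions of [d]-balls. *)
Lemma connected_chain S p q d : connected S -> S p -> S q -> 0 < d ->
  exists s : seq plane, [/\ last p s = q, forall a, List.In a (p :: s) -> S a &
    forall t, List.In t (steps p s) -> ball t.1 d t.2].
Proof.
move=> cS Sp Sq d0.
pose B := [set q | S q /\ exists s : seq plane,
  [/\ last p s = q, forall a, List.In a (p :: s) -> S a &
    forall t, List.In t (steps p s) -> ball t.1 d t.2]].
have Bball x y : S y -> B x -> ball x d y -> B y.
  move=> Sy [Sx [s [lx sS sd]]] xy; split=> //; exists (rcons s y).
  split; first by rewrite last_rcons.
    move=> a; rewrite -rcons_cons => h.
    by case: (In_rcons h) => [h'|->]; [apply: sS|].
  move=> t; have -> : steps p (rcons s y) = rcons (steps p s) (x, y).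
    rewrite -lx; elim: (s) {Sp Sx lx B sS sd} p => [|b r IH] a //=.
    by rewrite IH.
  by move=> h; case: (In_rcons h) => [h'|->]; [apply: sd|].
suff eSB : B = S by have [] : B q by rewrite eSB.
apply: cS.
- exists p; split=> //; exists [::]; split=> //= a; by case=> // <-.
- exists (\bigcup_(x in B) ball x d).
    by apply: bigcup_open => x _; apply: ball_open.
  apply/seteqP; split => [x Bx|x [Sx [y By yx]]]; last exact: Bball yx.
  by split; [case: Bx|exists x => //; apply: ballxx].
- exists (~` \bigcup_(x in S `\` B) ball x d).
    by apply: open_closedC; apply: bigcup_open => x _; apply: ball_open.
  apply/seteqP; split => [x Bx|x [Sx nx]].
    split; first by case: Bx.
    by case=> y [Sy nBy] yx; apply: nBy; apply: (Bball x) => //; apply: ball_sym.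
  apply: contrapT => nB; apply: nx; exists x => //; exact: ballxx.
Qed.

(** Since [T] is closed, some gap works around each point of [S]; the near-covering form of
    compactness along [0^'+] makes it uniform. *)
Lemma compact_gap S T : compact S -> compact T -> S `&` T = set0 ->
  exists2 d, 0 < d & forall p q, S p -> T q -> ~ ball p d q.
Proof.
move=> cS cT ST.
have clT : closed T by apply: compact_closed => //; exact: norm_hausdorff.
have/compact_near_coveringP ncS := cS.
have /= := ncS R (0^'+) (fun d p => forall q, T q -> ~ ball p d q) _.
case.
  move=> p Sp.
  have nTp : ~ T p by move=> Tp; have : (S `&` T) p by []; rewrite ST.
  have : nbhs p (~` T) by apply: open_nbhs_nbhs; split=> //; exact: closed_openC.
  case/nbhs_ballP => e /= e0 eT.
  exists (ball p (e / 2), [set d | d < e / 2]); first split => /=.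
  - by apply: nbhsx_ballx; rewrite divr_gt0.
  - by apply: nbhs_right_lt; rewrite divr_gt0.
  case=> x d /= [px de] q Tq xq; apply: (eT q) => //.
  by rewrite [e]splitr; apply: ball_triangle px _; apply: le_ball xq; apply: ltW.
move=> d /= d0 H.
exists (d / 2); first by rewrite divr_gt0.
move=> p q Sp Tq; apply: (H (d / 2)) => //=; last by rewrite divr_gt0.
rewrite sub0r normrN gtr0_norm ?divr_gt0 //.
by rewrite ltr_pdivrMr // ltr_pMr // ltr1n.
Qed.

(* Ties between coordinates are broken by labels, as if the points with label [n]
   had been shifted by [eps * n]: points with distinct labels are then always in
   general position.  The crossing parity argument needs no transitivity. *)
Definition label_lt (a b : R * nat) : bool :=
  (a.1 < b.1) || ((a.1 == b.1) && (a.2 < b.2)%N).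

Lemma label_lt_generic a b : a.2 != b.2 -> generic label_lt a b.
Proof.
rewrite /generic /label_lt [b.1 == _]eq_sym.
by case: (ltgtP a.1 b.1) => //= _; case: ltngtP.
Qed.

(** Labels decide ties only, so [x.1] still lies weakly between [a.1] and [b.1]: the formal
    perturbation costs nothing in distances. *)
Lemma label_lt_between a b x :
  between label_lt a b x -> `|x.1 - a.1| <= `|a.1 - b.1|.
Proof.
rewrite /between /label_lt.
have h1 := ler_norm (a.1 - b.1); have h2 := ler_norm (b.1 - a.1).
rewrite distrC in h2; move: `|a.1 - b.1| h1 h2 => n h1 h2.
by case: (ltgtP a.1 x.1); case: (ltgtP b.1 x.1) => //= h3 h4 _;
  rewrite ler_norml; apply/andP; split; lra.
Qed.

Definition label (n : nat) (p : plane) : (R * nat) * (R * nat) :=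
  ((p.1, n), (p.2, n)).
Definition unlabel (p : (R * nat) * (R * nat)) : plane := (p.1.1, p.2.1).

Lemma labelK n : cancel (label n) unlabel.
Proof. by case. Qed.

(** If the horizontal part of [s] meets the vertical part of [t], then the start of [s] and the end
    of [t] differ by less than [d] in either coordinate, which is enough for the sup norm. The other
    kind of crossing is symmetric. *)
Lemma cross_near (s t : (_ * _) * (_ * _)) d :
  ball (unlabel s.1) d (unlabel s.2) -> ball (unlabel t.1) d (unlabel t.2) ->
  cross label_lt s t ->
  ball (unlabel s.1) d (unlabel t.2) \/ ball (unlabel s.2) d (unlabel t.1).
Proof.
rewrite /cross; case=> /= s1 s2 [/= t1 t2].
set b1 := _ && _; have [B1 _|] := boolP b1.
  left; have /andP[x y] := B1; split=> /=; rewrite /ball /=.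
    by rewrite distrC (le_lt_trans (label_lt_between x)).
  apply: le_lt_trans t2.
  move: y; rewrite /between addbC => /label_lt_between.
  by rewrite [X in _ <= X]distrC.
move=> _ /andP[x y]; right; split=> /=; rewrite /ball /=.
  apply: le_lt_trans t1.
  exact: label_lt_between x.
apply: le_lt_trans s2.
move: y; rewrite /between addbC => /label_lt_between.
by rewrite distrC [X in _ <= X]distrC.
Qed.
End PlaneSets.

Section K5Sets.
Variable R : realType.
Local Open Scope classical_set_scope.
Local Open Scope ring_scope.
Notation plane := (R * R)%type.

Lemma compact_gap_near (S T : set plane) :
  compact S -> compact T -> S `&` T = set0 ->
  \forall d \near 0^'+, forall p q, S p -> T q -> ~ ball p d q.
Proof.
move=> cS cT /(compact_gap cS cT)[d d0 H]; near=> e => p q Sp Tq pq.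
apply: (H p q) => //; apply: le_ball pq; near: e.
exact: nbhs_right_le.
Unshelve. all: by end_near. Qed.

Lemma In_steps_label n e j (p q : plane) s d :
  0 < d -> last p s = q ->
  (forall t, List.In t (steps p s) -> ball t.1 d t.2) ->
  forall t, List.In t (steps (label n p) (rcons (map (label e) s) (label j q))) ->
  ball (unlabel t.1) d (unlabel t.2).
Proof.
move=> d0; elim: s n p => [|a s IH] n p /= lq sd t.
  by case=> // <- /=; rewrite !labelK lq; apply: ballxx.
case=> [<-|] /=; first by rewrite !labelK; apply: (sd (p, a)); left.
by apply: IH => // u us; apply: sd; right.
Qed.

Lemma In_label n e j (p q : plane) s (S : set plane) :
  (forall a, List.In a (p :: s) -> S a) -> S q ->
  forall t, List.In t (label n p :: rcons (map (label e) s) (label j q)) ->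
  exists m a, [/\ t = label m a, S a & (m \in [:: n; e; j])%N].
Proof.
move=> sS Sq t; case=> [<-|h].
  by exists n, p; split; [|apply: sS; left|rewrite !inE eqxx].
case: (In_rcons h) => [|->]; last first.
  by exists j, q; split; rewrite // !inE eqxx !orbT.
have : forall a, List.In a s -> S a by move=> a as_; apply: sS; right.
elim: (s) => [|b r IH] //= rS [<-|].
  by exists e, b; split; [|apply: rS; left|rewrite !inE eqxx orbT].
by apply: IH => a ar; apply: rS; right.
Qed.

(** Compactness gives a uniform gap [d] between independent edges, and connectedness gives chains of
    step less than [d] in each edge. By [cross_near], a crossing of two such chains would bring
    points of independent edges closer than the gap. *)
Theorem K5_sets (z : nat -> plane) (S : nat -> nat -> set plane) :
    (forall i j, (i < j < 5)%N ->
      [/\ compact (S i j), connected (S i j), S i j (z i) & S i j (z j)]) ->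
    (forall i j k l, (i < j < 5)%N -> (k < l < 5)%N -> uniq [:: i; j; k; l] ->
      S i j `&` S k l = set0) ->
  False.
Proof.
move=> SP S0.
have [d [d0 gap]] : exists d : R, 0 < d /\
    forall t : 'I_5 * 'I_5 * 'I_5 * 'I_5,
    let: (i, j, k, l) := t in (i < j)%N -> (k < l)%N ->
    uniq [:: i : nat; j : nat; k : nat; l : nat] ->
    forall p q, S i j p -> S k l q -> ~ ball p d q.
  have : \forall d \near (0:R)^'+, forall t : 'I_5 * 'I_5 * 'I_5 * 'I_5,
      let: (i, j, k, l) := t in (i < j)%N -> (k < l)%N ->
    uniq [:: i : nat; j : nat; k : nat; l : nat] ->
      forall p q, S i j p -> S k l q -> ~ ball p d q.
    apply: filter_forall => -[[[i j] k] l] /=.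
    have [/and3P[ij kl u]|n] :=
      boolP [&& (i < j)%N, (k < l)%N & uniq [:: i : nat; j : nat; k : nat; l : nat]].
      have ij5 : (i < j < 5)%N by rewrite ij ltn_ord.
      have kl5 : (k < l < 5)%N by rewrite kl ltn_ord.
      have [cij _ _ _] := SP i j ij5; have [ckl _ _ _] := SP k l kl5.
      have := compact_gap_near cij ckl (S0 _ _ _ _ ij5 kl5 u).
      by apply: filterS => d dP _ _ _.
    near=> d => ij kl u; case/negP: n; exact/and3P.
  move=> H.
  have [d []] := filter_ex (filterI (@nbhs_right_gt R 0) H).
  by exists d.
have chains (ij : nat * nat) : exists s : seq plane, (ij.1 < ij.2 < 5)%N ->
    [/\ last (z ij.1) s = z ij.2,
     forall a, List.In a (z ij.1 :: s) -> S ij.1 ij.2 a &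
     forall t, List.In t (steps (z ij.1) s) -> ball t.1 d t.2].
  have [h|h] := boolP (ij.1 < ij.2 < 5)%N; last by exists [::].
  have [_ cS Si Sj] := SP _ _ h.
  by have [s sP] := connected_chain cS Si Sj d0; exists s.
have [c cP] := choice chains.
pose zl i := label i (z i).
(* Vertices keep labels below 5; the inner points of the chain from [i] to [j] are labelled by an
   injective code of the pair, at least 5. Independent edges thus share no label. *)
pose P i j := rcons (map (label (5 + 5 * i + j)) (c (i, j))) (zl j).
have Plast i j : (i < j < 5)%N -> last (zl i) (P i j) = zl j.
  by rewrite /P last_rcons.
have PIn i j t : (i < j < 5)%N -> List.In t (zl i :: P i j) ->
    exists m a, [/\ t = label m a, S i j a & (m \in [:: i; 5 + 5 * i + j; j])%N].
  move=> ij; have [_ _ _ Sj] := SP _ _ ij; have [_ cS _] := cP (i, j) ij.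
  exact: In_label.
have Pgen i j k l : (i < j < 5)%N -> (k < l < 5)%N -> uniq [:: i; j; k; l] ->
    forall a b, List.In a (zl i :: P i j) -> List.In b (zl k :: P k l) ->
    gen_pt (@label_lt R) a b.
  move=> ij kl u a b /(PIn _ _ _ ij)[m [p [-> _ mi]]] /(PIn _ _ _ kl)[n [q [-> _ nk]]].
  have mn : m != n.
    move: mi nk u; rewrite /= !inE; lia.
  by rewrite /gen_pt !label_lt_generic.
have [i [j [k [l [ij kl u]]]]] := K5_crossing Plast Pgen.
apply/negP; apply/negPf; apply: crossing_free0 => s t sP tP.
apply/negP => st.
have s_d : ball (unlabel s.1) d (unlabel s.2).
  have [cl _ cd] := cP (i, j) ij.
  by apply: (In_steps_label d0 cl cd) sP.
have t_d : ball (unlabel t.1) d (unlabel t.2).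
  have [cl _ cd] := cP (k, l) kl.
  by apply: (In_steps_label d0 cl cd) tP.
have Ss x : List.In x (zl i :: P i j) -> S i j (unlabel x).
  by case/(PIn _ _ _ ij) => m [a [-> ? _]]; rewrite labelK.
have St x : List.In x (zl k :: P k l) -> S k l (unlabel x).
  by case/(PIn _ _ _ kl) => m [a [-> ? _]]; rewrite labelK.
have [/Ss s1 /Ss s2] := mem_steps sP; have [/St t1 /St t2] := mem_steps tP.
have [i5 j5 k5 l5] : [/\ (i < 5)%N, (j < 5)%N, (k < 5)%N & (l < 5)%N] by split; lia.
have := gap (Ordinal i5, Ordinal j5, Ordinal k5, Ordinal l5) => /=.
case/andP: ij => ij _; case/andP: kl => kl _.
move=> /(_ ij kl u) {}gap.
by case: (cross_near s_d t_d st); apply: gap.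
Unshelve. all: by end_near. Qed.
End K5Sets.

(** * Trimming a plane drawing *)

Section Trimming.
Variable R : realType.
Local Open Scope classical_set_scope.
Local Open Scope ring_scope.
Notation plane := (R * R)%type.
Implicit Types (a b c : R).

Lemma compact_sublevel (g : R -> R) a b c : {within `[a, b], continuous g} ->
  compact [set t | t \in `[a, b] /\ g t <= c].
Proof.
move=> /continuousP cg; have := cg [set x | c < x] (open_gt (y:=c)).
rewrite -closedC => /closed_subspaceP[V clV VE].
have -> : [set t | t \in `[a, b] /\ g t <= c] = `[a, b] `&` V.
  rewrite setIC VE; apply/seteqP; split => t /= [].
    by move=> tab gt; split=> //; apply/negP; rewrite -leNgt.
  by move=> /negP; rewrite -leNgt.
exact/compact_closedI/clV/segment_compact.
Qed.

(** The exit time is the maximum of the compact sublevel set; the intermediate value theorem on the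
    remaining interval shows that the level is attained there exactly. *)
Lemma last_exit (g : R -> R) a b c : a <= b -> {within `[a, b], continuous g} ->
  g a <= c -> c < g b ->
  exists s, [/\ s \in `[a, b], g s = c & forall t, t \in `[a, b] -> s < t -> c < g t].
Proof.
move=> ab cg ga gb.
have [|||s] := @compact_EVT_max _ _ (@idfun R) [set t | t \in `[a, b] /\ g t <= c].
- by exists a; split=> //; rewrite bound_itvE.
- exact: compact_sublevel.
- by apply: continuous_subspaceT => x; exact: cvg_id.
rewrite inE => -[sab gs] smax.
have smax' t : t \in `[a, b] -> s < t -> c < g t.
  move=> tab; apply: contraTT; rewrite -!leNgt => gt.
  by apply: smax; rewrite inE.
move: (sab); rewrite in_itv /= => /andP[a_s s_b].
have sbab : `[s, b] `<=` `[a, b].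
  by move=> t; rewrite /= !in_itv /= => /andP[st ->]; rewrite (le_trans a_s).
have [||t tsb gt] := @IVT R g s b c s_b.
- exact: continuous_subspaceW cg.
- by rewrite ge_min gs /= le_max (ltW gb) orbT.
exists s; split=> //.
have : t <= s by rewrite leNgt; apply/negP => /(smax' t (sbab t tsb)); rewrite gt ltxx.
move: tsb; rewrite in_itv /= => /andP[st _] ts.
by rewrite -gt; congr g; apply/eqP; rewrite eq_le st.
Qed.

Lemma first_entry (g : R -> R) a b c : a <= b -> {within `[a, b], continuous g} ->
  c < g a -> g b <= c ->
  exists s, [/\ s \in `[a, b], g s = c & forall t, t \in `[a, b] -> t < s -> c < g t].
Proof.
move=> ab cg ga gb.
have [|||s] := @compact_EVT_min _ _ (@idfun R) [set t | t \in `[a, b] /\ g t <= c].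
- by exists b; split=> //; rewrite bound_itvE.
- exact: compact_sublevel.
- by apply: continuous_subspaceT => x; exact: cvg_id.
rewrite inE => -[sab gs] smin.
have smin' t : t \in `[a, b] -> t < s -> c < g t.
  move=> tab; apply: contraTT; rewrite -!leNgt => gt.
  by apply: smin; rewrite inE.
move: (sab); rewrite in_itv /= => /andP[a_s s_b].
have asab : `[a, s] `<=` `[a, b].
  by move=> t; rewrite /= !in_itv /= => /andP[-> ts]; rewrite (le_trans ts).
have [||t tas gt] := @IVT R g a s c a_s.
- exact: continuous_subspaceW cg.
- by rewrite ge_min gs orbT /= le_max (ltW ga).
exists s; split=> //.
have : s <= t by rewrite leNgt; apply/negP => /(smin' t (asab t tas)); rewrite gt ltxx.
move: tas; rewrite in_itv /= => /andP[_ ts] st.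
by rewrite -gt; congr g; apply/eqP; rewrite eq_le st.
Qed.

Lemma is_arc_compact (x y : plane) S : is_arc x y S -> compact S.
Proof.
by case=> f [cf _ _ _ <-]; apply: continuous_compact => //; exact: segment_compact.
Qed.

(** The first entry into the disc of [y] is sought only after the last exit from the disc of [x]. It
    exists because [r *+ 2 < |x - y|] keeps the exit point outside the disc of [y]. *)
Lemma arc_trim (x y : plane) S (r : R) : is_arc x y S ->
    0 < r -> r *+ 2 < `|x - y| ->
  exists T p q, [/\ compact T, connected T, T `<=` S, T p & T q] /\
    [/\ `|p - x| = r, `|q - y| = r,
        forall z, T z -> `|z - x| <= r -> z = p &
        forall z, T z -> `|z - y| <= r -> z = q].
Proof.
case=> f [cf _ f0 f1 <-] r0 xy.
have cn (c : plane) : {within `[0, 1], continuous (fun t => `|f t - c|)}.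
  by move=> t; apply: cvg_norm; apply: cvgB; [exact: cf|exact: cvg_cst].
have rxy : r < `|x - y|.
  by apply: lt_trans xy; rewrite mulr2n ltrDl.
have [||s [s01 fs sP]] := @last_exit _ 0 1 r ler01 (cn x).
- by rewrite f0 subrr normr0 ltW.
- by rewrite f1 distrC.
move: (s01); rewrite in_itv /= => /andP[s0 s1].
have ss1 : `[s, 1] `<=` `[0, 1].
  by move=> t; rewrite /= !in_itv /= => /andP[st ->]; rewrite (le_trans s0).
have [|||t [t_s1 ft tP]] := @first_entry (fun t => `|f t - y|) s 1 r s1.
- exact: continuous_subspaceW (cn y).
- rewrite ltNge; apply/negP => fy.
  have := ler_distD (f s) x y; rewrite leNgt => /negP; apply.
  by apply: le_lt_trans xy; rewrite mulr2n distrC fs lerD.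
- by rewrite f1 subrr normr0 ltW.
move: (t_s1); rewrite in_itv /= => /andP[s_t t1].
have st01 : `[s, t] `<=` `[0, 1].
  move=> u; rewrite /= !in_itv /= => /andP[su ut].
  by rewrite (le_trans s0 su) (le_trans ut t1).
have cfst := continuous_subspaceW st01 cf.
exists (f @` `[s, t]), (f s), (f t); split; split=> //.
- by apply: continuous_compact => //; exact: segment_compact.
- by apply: connected_continuous_connected => //; exact: segment_connected.
- by move=> _ [u /st01 u01 <-]; exists u.
- by exists s => //=; rewrite bound_itvE.
- by exists t => //=; rewrite bound_itvE.
- move=> _ [u ust <-]; apply: contraPP => us; rewrite leNgt; apply/negP/negPn.
  apply: sP; first exact: st01.
  move: ust; rewrite /= in_itv /= lt_neqAle => /andP[-> _]; rewrite andbT.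
  by apply/eqP => su; apply: us; rewrite su.
- move=> _ [u ust <-]; apply: contraPP => us; rewrite leNgt; apply/negP/negPn.
  move: ust; rewrite /= in_itv /= => /andP[su ut].
  apply: tP; first by rewrite in_itv /= su (le_trans ut).
  rewrite lt_neqAle ut andbT.
  by apply/eqP => tu; apply: us; rewrite tu.
Qed.
End Trimming.

Section CleanDrawing.
Variable R : realType.
Variables (V : finType) (e : rel V).
Local Open Scope classical_set_scope.
Local Open Scope ring_scope.
Notation plane := (R * R)%type.

(* [T u v] is the part of the edge uv between its last exit [q u v] from the disc
   of radius [r] around [pt u] and its first entry [q v u] into that of [pt v]. *)
Record clean_drawing (pt : V -> plane) (r : R) (q : V -> V -> plane)
    (T : V -> V -> set plane) : Prop := {
  cd_r0 : 0 < r;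
  cd_ball : forall u v, u != v -> forall z, `|z - pt u| <= r -> r < `|z - pt v|;
  cd_sym : forall u v, T u v = T v u;
  cd_compact : forall u v, e u v -> compact (T u v);
  cd_connected : forall u v, e u v -> connected (T u v);
  cd_end : forall u v, e u v -> T u v (q u v);
  cd_exit : forall u v, e u v -> `|q u v - pt u| = r;
  cd_exitP : forall u v z, e u v -> T u v z -> `|z - pt u| <= r -> z = q u v;
  cd_avoid : forall u v w z, e u v -> T u v z -> w != u -> w != v ->
    r < `|z - pt w|;
  cd_disj : forall u v x y, e u v -> e x y -> [set u; v]%SET != [set x; y]%SET ->
    forall z, T u v z -> ~ T x y z }.

Hypotheses (e_sym : symmetric e) (e_irr : irreflexive e).

Lemma near0_lt_norm (z : plane) : z != 0 -> \forall r \near (0:R)^'+, r *+ 2 < `|z|.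
Proof.
move=> z0; near=> r.
rewrite -mulr_natr -ltr_pdivlMr //; near: r; apply: nbhs_right_lt.
by rewrite divr_gt0 // normr_gt0.
Unshelve. all: by end_near. Qed.

Lemma set2_eq (u v x y : V) : [set u; v]%SET = [set x; y]%SET ->
  (u = x /\ v = y) \/ (u = y /\ v = x).
Proof.
move=> E.
have := finset.set21 u v; have := finset.set22 u v; rewrite E !finset.in_set2.
have := finset.set21 x y; have := finset.set22 x y; rewrite -E !finset.in_set2.
by do 4!case/orP=> /eqP ?; subst; auto.
Qed.

(** The radius has to be less than half of each distance between vertices and less than the distance
    from each edge to each vertex not on it. These are finitely many conditions, each true near
    [0^'+]. *)
Lemma planar_clean : planar R e -> exists pt r q T, @clean_drawing pt r q T.
Proof.
case=> pt [E [pt_inj Earc Ept Eint]].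
have neq u v : e u v -> u != v by apply: contraTneq => ->; rewrite e_irr.
have ptN u v : u != v -> pt u - pt v != 0.
  by rewrite subr_eq0; apply: contra_neq => /pt_inj.
have [r [r0 rpt rE]] : exists r : R, [/\ 0 < r,
    forall uv : V * V, uv.1 != uv.2 -> r *+ 2 < `|pt uv.1 - pt uv.2| &
    forall t : V * V * V, e t.1.1 t.1.2 -> t.2 != t.1.1 -> t.2 != t.1.2 ->
      forall z, E [set t.1.1; t.1.2]%SET z -> r < `|z - pt t.2|].
  have H1 : \forall r \near (0:R)^'+, forall uv : V * V, uv.1 != uv.2 ->
      r *+ 2 < `|pt uv.1 - pt uv.2|.
    apply: filter_forall => -[u v] /=.
    have [->|uv] := eqVneq u v; first by apply: nearW.
    by apply: filterS (near0_lt_norm (ptN _ _ uv)) => r rP _.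
  have H2 : \forall r \near (0:R)^'+, forall t : V * V * V, e t.1.1 t.1.2 ->
      t.2 != t.1.1 -> t.2 != t.1.2 ->
      forall z, E [set t.1.1; t.1.2]%SET z -> r < `|z - pt t.2|.
    apply: filter_forall => -[[u v] w] /=.
    have [uv|] := boolP (e u v); last by move=> _; apply: nearW.
    have [->|wu] := eqVneq w u; first by apply: nearW.
    have [->|wv] := eqVneq w v; first by apply: nearW.
    have cE := is_arc_compact (Earc _ _ uv).
    have wE : E [set u; v]%SET `&` [set pt w] = set0.
      apply/seteqP; split=> // z [+ zw]; rewrite zw => /(Ept _ _ _ uv).
      by case=> wE; [move: wu|move: wv]; rewrite wE eqxx.
    have [d d0 dP] := compact_gap cE (@compact_set1 _ (pt w)) wE.
    near=> r => _ _ _ z Ez; rewrite ltNge; apply/negP => zr.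
    apply: (dP z (pt w)) => //.
    rewrite ball_prod_normE /ball_ /=; apply: le_lt_trans zr _.
    by near: r; apply: nbhs_right_lt.
  have [r [r0 [rpt rE]]] := filter_ex (filterI (@nbhs_right_gt R 0) (filterI H1 H2)).
  by exists r.
(* The choice is made once per unordered pair, with both exits as a function of the vertex, so that
   [T u v = T v u] holds by construction. *)
have trim (s : {set V}) : exists Tq : set plane * (V -> plane),
    forall u v, s = [set u; v]%SET -> e u v ->
    [/\ compact Tq.1, connected Tq.1, Tq.1 `<=` E s & Tq.1 (Tq.2 u)] /\
    [/\ `|Tq.2 u - pt u| = r & forall z, Tq.1 z -> `|z - pt u| <= r -> z = Tq.2 u].
  have [[u [v [-> uv]]]|n] := pselect (exists u v, s = [set u; v]%SET /\ e u v);
    last by exists (set0, pt) => u v su uv; case: n; exists u, v.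
  have [T [p [q [[cT kT TE Tp Tq] [np nq pP qP]]]]] :=
    arc_trim (Earc _ _ uv) r0 (rpt (u, v) (neq _ _ uv)).
  exists (T, fun w => if w == u then p else q) => x y /set2_eq[][<- <-] xy /=.
    by rewrite eqxx.
  by rewrite eq_sym (negPf (neq _ _ uv)).
have [Tq TqP] := choice trim.
have TqP' u v (uv : e u v) := TqP _ u v erefl uv.
have far u v : u != v -> forall z, `|z - pt u| <= r -> r < `|z - pt v|.
  move=> uv z zu; rewrite ltNge; apply/negP => zv.
  have := ler_distD z (pt u) (pt v); rewrite leNgt => /negP; apply.
  by apply: le_lt_trans (rpt (u, v) uv); rewrite mulr2n distrC lerD.
exists pt, r, (fun u v => (Tq [set u; v]%SET).2 u), (fun u v => (Tq [set u; v]%SET).1).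
split=> //.
- by move=> u v; rewrite finset.setUC.
- by move=> u v /TqP'[[]].
- by move=> u v /TqP'[[]].
- by move=> u v /TqP'[[]].
- by move=> u v /TqP'[_ []].
- by move=> u v z /TqP'[_ []] _; apply.
- move=> u v w z uv; have [[_ _ TE _] _] := TqP' _ _ uv.
  by move=> /TE Ez wu wv; apply: (rE (u, v, w)).
- move=> u v x y uv xy neq_s z.
  have [[_ _ TE _] [nu uP]] := TqP' _ _ uv; have [[_ _ TE' _] _] := TqP' _ _ xy.
  have [_ [nv vP]] := TqP _ v u (finset.setUC _ _) (etrans (e_sym _ _) uv).
  (* A common point would be a vertex, hence an end of [uv]. But a trimmed edge meets the disc of an
     end only at the exit, at distance [r > 0] from the centre. *)
  move=> Tz Tz'; have [w _ wz] := Eint _ _ _ _ uv xy neq_s z (conj (TE _ Tz) (TE' _ Tz')).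
  move: (TE _ Tz); rewrite -wz => /(Ept _ _ _ uv)[] wE; subst w.
    have := uP _ Tz; rewrite -wz subrr normr0 => /(_ (ltW r0)) E1.
    by move: nu; rewrite -E1 subrr normr0 => r0'; rewrite -r0' ltxx in r0.
  have := vP _ Tz; rewrite -wz subrr normr0 => /(_ (ltW r0)) E1.
  by move: nv; rewrite -E1 subrr normr0 => r0'; rewrite -r0' ltxx in r0.
Unshelve. all: by end_near. Qed.
End CleanDrawing.

(** * Directions and sectors *)

Section Directions.
Variable R : realType.
Local Open Scope ring_scope.
Notation plane := (R * R)%type.
Implicit Types (x y z h : plane) (t : R).

(* [before] is the counterclockwise order of directions, starting from the positive
   x-axis; within each half-open half plane it is given by the determinant. *)
Definition lower x : bool := (x.2 < 0) || ((x.2 == 0) && (x.1 < 0)).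
Definition pdet x y : R := x.1 * y.2 - x.2 * y.1.
Definition before x y : bool :=
  (~~ lower x && lower y) || ((lower x == lower y) && (0 < pdet x y)).
Definition same_ray x y : bool := (lower x == lower y) && (pdet x y == 0).

Lemma lowerPn x : x != 0 -> lower x = false -> 0 < x.2 \/ x.2 = 0 /\ 0 < x.1.
Proof.
case: x => a b /=; rewrite /lower xpair_eqE /= => x0.
case: (ltgtP b 0) x0 => //= [b0|b0]; first by left.
by case: (ltgtP a 0) => // a0; right; rewrite b0.
Qed.

Lemma lowerP x : lower x -> x.2 < 0 \/ x.2 = 0 /\ x.1 < 0.
Proof. by case/orP=> [|/andP[/eqP]]; auto. Qed.

Lemma before_trans x y z : x != 0 -> y != 0 -> z != 0 ->
  before x y -> before y z -> before x z.
Proof.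
move=> x0 y0 z0; rewrite /before.
case lx: (lower x); case ly: (lower y); case lz: (lower z) => //=.
- move: x y z x0 y0 z0 lx ly lz => x y z x0 y0 z0 lx ly lz.
  move: (lowerP lx) (lowerP ly) (lowerP lz); rewrite /pdet.
  move: (x) (y) (z) => [a b] [c d] [m n] /=.
  case=> [?|[-> ?]]; case=> [?|[-> ?]]; case=> [?|[-> ?]]; rewrite ?mul0r ?mulr0; nra.
move: (lowerPn x0 lx) (lowerPn y0 ly) (lowerPn z0 lz); rewrite /pdet.
move: (x) (y) (z) => [a b] [c d] [m n] /=.
case=> [?|[-> ?]]; case=> [?|[-> ?]]; case=> [?|[-> ?]]; rewrite ?mul0r ?mulr0; nra.
Qed.
End Directions.

Section Sectors.
Variable R : realType.
Local Open Scope ring_scope.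
Notation plane := (R * R)%type.
Implicit Types (x y z h c p : plane) (t r : R).

Lemma plane_norm_le z r : (`|z| <= r) = (`|z.1| <= r) && (`|z.2| <= r).
Proof. by rewrite prod_normE ge_max. Qed.

Definition comb t x y : plane :=
  ((1 - t) * x.1 + t * y.1, (1 - t) * x.2 + t * y.2).

Lemma combB t p q c : comb t p q - c = comb t (p - c) (q - c).
Proof. by congr (_, _) => /=; ring. Qed.

Lemma comb0 x y : comb 0 x y = x.
Proof. by case: x => a b; congr (_, _) => /=; ring. Qed.

Lemma comb1 x y : comb 1 x y = y.
Proof. by case: y => a b; congr (_, _) => /=; ring. Qed.

Lemma comb_norm t x y r : 0 <= t <= 1 -> `|x| <= r -> `|y| <= r -> `|comb t x y| <= r.
Proof.
move=> /andP[t0 t1]; rewrite !plane_norm_le => /andP[x1 x2] /andP[y1 y2] /=.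
move: x1 x2 y1 y2; rewrite !ler_norml.
move=> /andP[? ?] /andP[? ?] /andP[? ?] /andP[? ?].
by apply/andP; split; apply/andP; split; nra.
Qed.

Lemma neq0_coord z : (0 < z.2 \/ z.2 = 0 /\ 0 < z.1) \/ (z.2 < 0 \/ z.2 = 0 /\ z.1 < 0) ->
  z != 0.
Proof.
move=> H; apply/eqP => z0; move: H; rewrite z0 /= ltxx.
by case=> -[|[]].
Qed.

(** A half-open half plane without the origin is a convex cone; this is the reason for splitting the
    directions into two such halves. *)
Lemma comb_lower t x y : 0 <= t <= 1 -> x != 0 -> y != 0 -> lower x = lower y ->
  comb t x y != 0 /\ lower (comb t x y) = lower x.
Proof.
move=> /andP[t0 t1] x0 y0; case lx: (lower x) => /esym ly.
  have H : (comb t x y).2 < 0 \/ (comb t x y).2 = 0 /\ (comb t x y).1 < 0.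
    move: (lowerP lx) (lowerP ly) => /=.
    have [->|tn0] := eqVneq t 0; first by rewrite subr0 !mul1r !mul0r !addr0.
    have [->|tn1] := eqVneq t 1; first by rewrite subrr !mul1r !mul0r !add0r.
    have {}t0 : 0 < t by rewrite lt_neqAle eq_sym tn0.
    have {}t1 : t < 1 by rewrite lt_neqAle tn1.
    by case=> [?|[-> ?]]; case=> [?|[-> ?]]; first [by left; nra|by right; split; nra].
  split; first by apply: neq0_coord; auto.
  by rewrite /lower; case: H => [->|[-> ->]]; rewrite ?eqxx ?ltxx.
have H : 0 < (comb t x y).2 \/ (comb t x y).2 = 0 /\ 0 < (comb t x y).1.
  move: (lowerPn x0 lx) (lowerPn y0 ly) => /=.
  have [->|tn0] := eqVneq t 0; first by rewrite subr0 !mul1r !mul0r !addr0.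
  have [->|tn1] := eqVneq t 1; first by rewrite subrr !mul1r !mul0r !add0r.
  have {}t0 : 0 < t by rewrite lt_neqAle eq_sym tn0.
  have {}t1 : t < 1 by rewrite lt_neqAle tn1.
  by case=> [?|[-> ?]]; case=> [?|[-> ?]]; first [by left; nra|by right; split; nra].
split; first by apply: neq0_coord; auto.
rewrite /lower; case: H => [h|[-> h]]; first by rewrite ltNge (ltW h) (gt_eqF h).
by rewrite ltxx eqxx /= ltNge ltW.
Qed.

Lemma pdet_comb t h x y : pdet h (comb t x y) = (1 - t) * pdet h x + t * pdet h y.
Proof. by rewrite /pdet /=; ring. Qed.

Lemma comb_before t h x y : 0 <= t <= 1 -> x != 0 -> y != 0 -> lower x = lower y ->
  before h x = before h y -> before h (comb t x y) = before h x.
Proof.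
move=> t01 x0 y0 xy; have [_ lc] := comb_lower t01 x0 y0 xy.
move: t01 => /andP[t0 t1]; rewrite /before lc -xy pdet_comb.
case: (lower h); case: (lower x) => //=.
  case: (ltP 0 (pdet h x)); case: (ltP 0 (pdet h y)) => // hy hx _.
    by apply/idP; nra.
  by apply/negbTE; rewrite -leNgt; nra.
case: (ltP 0 (pdet h x)); case: (ltP 0 (pdet h y)) => // hy hx _.
  by apply/idP; nra.
by apply/negbTE; rewrite -leNgt; nra.
Qed.

Lemma comb_same_ray t h x y : 0 <= t <= 1 -> x != 0 -> y != 0 -> lower x = lower y ->
  before h x = before h y -> ~~ same_ray h x -> ~~ same_ray h y ->
  ~~ same_ray h (comb t x y).
Proof.
move=> t01 x0 y0 xy; have [_ lc] := comb_lower t01 x0 y0 xy.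
move: t01 => /andP[t0 t1]; rewrite /before /same_ray lc -xy pdet_comb.
by case: (lower h); case: (lower x) => //=;
  case: (ltgtP 0 (pdet h x)) => //= hx; case: (ltgtP 0 (pdet h y)) => //= hy _ _ _;
  apply/eqP; nra.
Qed.

Lemma same_ray_before h x y : x != 0 -> y != 0 -> same_ray x y ->
  before h x = before h y.
Proof.
move=> x0 y0; rewrite /same_ray /before => /andP[/eqP lxy /eqP d0]; rewrite -lxy.
congr (_ || (_ && _)).
have E : x.2 * pdet h y = y.2 * pdet h x.
  transitivity (y.2 * pdet h x + h.2 * pdet x y); first by rewrite /pdet; ring.
  by rewrite d0 mulr0 addr0.
have E' : x.1 * pdet h y = y.1 * pdet h x.
  transitivity (y.1 * pdet h x + h.1 * pdet x y); first by rewrite /pdet; ring.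
  by rewrite d0 mulr0 addr0.
move: d0; rewrite {1}/pdet; move: (pdet h x) (pdet h y) E E' => dx dy.
move: lxy; case lx: (lower x) => /esym ly.
  move: (lowerP lx) (lowerP ly).
  move: (x) (y) => [a b] [c d] /=.
  case=> [b0|[bE a0]]; case=> [d0|[dE c0]] E E' D; try by exfalso; subst; nra.
    by rewrite -(nmulr_rlt0 dx d0) -E nmulr_rlt0.
  by rewrite -(nmulr_rlt0 dx c0) -E' nmulr_rlt0.
move: (lowerPn x0 lx) (lowerPn y0 ly).
move: (x) (y) => [a b] [c d] /=.
case=> [b0|[bE a0]]; case=> [d0|[dE c0]] E E' D; try by exfalso; subst; nra.
  by rewrite -(pmulr_rgt0 dx d0) -E pmulr_rgt0.
by rewrite -(pmulr_rgt0 dx c0) -E' pmulr_rgt0.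
Qed.

Lemma same_ray_scale t x : 0 < t -> same_ray x (comb t 0 x).
Proof.
move=> t0; apply/andP; split; last by apply/eqP; rewrite /pdet /=; ring.
rewrite /lower /= !mulr0 !add0r.
by rewrite !pmulr_rlt0 // mulf_eq0 (gt_eqF t0).
Qed.

Lemma scale_neq0 t x : 0 < t -> x != 0 -> comb t 0 x != 0.
Proof.
move=> t0; case: x => a b; rewrite /comb /= !mulr0 !add0r !xpair_eqE !mulf_eq0.
by rewrite (gt_eqF t0).
Qed.

Lemma same_ray_norm x y : x != 0 -> y != 0 -> same_ray x y -> `|x| = `|y| -> x = y.
Proof.
move=> x0 y0 /andP[/eqP lxy /eqP d0] nxy.
have le (u v : plane) : u != 0 -> v != 0 -> lower u = lower v -> pdet u v = 0 ->
    exists2 k, 0 < k & v = (k * u.1, k * u.2).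
  move=> {x0 y0 lxy d0 nxy}; case: u v => [a b] [c d] u0 v0 luv; rewrite /pdet /= => d0.
  move: luv; case lu: (lower (a, b)) => /esym lv.
    move: (lowerP lu) (lowerP lv) => /=.
    case=> [b0|[bE a0]] [d0'|[dE c0]].
    - exists (d / b); first by rewrite nmulr_lgt0 // invr_lt0.
      have bn0 : b != 0 by rewrite lt_eqF.
      congr (_, _); last by rewrite mulfVK.
      by rewrite mulrAC -[LHS](mulfK bn0); congr (_ / b); lra.
    - by exfalso; nra.
    - by exfalso; nra.
    exists (c / a); first by rewrite nmulr_lgt0 // invr_lt0.
    by rewrite dE bE mulr0; congr (_, _); rewrite mulfVK // lt_eqF.
  move: (lowerPn u0 lu) (lowerPn v0 lv) => /=.
  case=> [b0|[bE a0]] [d0'|[dE c0]].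
  - exists (d / b); first by rewrite divr_gt0.
    have bn0 : b != 0 by rewrite gt_eqF.
    congr (_, _); last by rewrite mulfVK.
    by rewrite mulrAC -[LHS](mulfK bn0); congr (_ / b); lra.
  - by exfalso; nra.
  - by exfalso; nra.
  exists (c / a); first by rewrite divr_gt0.
  by rewrite dE bE mulr0; congr (_, _); rewrite mulfVK // gt_eqF.
have [k k0 yE] := le _ _ x0 y0 lxy d0.
move: nxy; rewrite yE [in RHS]prod_normE /= !normrM (gtr0_norm k0) -maxr_pMr ?(ltW k0) //.
have -> : Num.max `|x.1| `|x.2| = `|x| by rewrite prod_normE.
move=> /esym nx; have nx0 : `|x| != 0 by rewrite normr_eq0.
have -> : k = 1 by apply: (mulIf nx0); rewrite nx mul1r.
by rewrite !mul1r; case: (x).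
Qed.

(* Adding [lower x] cuts the sector containing the negative x-axis in two, so that
   each sector is convex. *)
Definition sector (V : finType) (N : {set V}) (dir : V -> plane) x : nat :=
  (lower x + #|[set w in N | before (dir w) x]|)%N.

(** Both summands of [sector] are monotone along [before], the counted sets being nested by
    transitivity. Equal sums therefore force equal summands and equal sets. Incomparable directions
    lie on one ray. *)
Lemma sector_eq (V : finType) (N : {set V}) (dir : V -> plane) x y :
    (forall w, w \in N -> dir w != 0) -> x != 0 -> y != 0 ->
    sector N dir x = sector N dir y ->
  lower x = lower y /\ forall w, w \in N -> before (dir w) x = before (dir w) y.
Proof.
move=> dir0.
have main (u v : plane) : u != 0 -> v != 0 -> before u v -> sector N dir u = sector N dir v ->
    lower u = lower v /\ forall w, w \in N -> before (dir w) u = before (dir w) v.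
  move=> u0 v0 uv; rewrite /sector.
  have sub : [set w in N | before (dir w) u] \subset [set w in N | before (dir w) v].
    apply/fintype.subsetP => w; rewrite !finset.inE => /andP[wN wu]; rewrite wN /=.
    exact: (before_trans (dir0 _ wN) u0 v0 wu uv).
  have luv : (lower u <= lower v)%N.
    by move: uv; rewrite /before; case: (lower u); case: (lower v).
  move=> E; have cle := subset_leq_card sub.
  have lE : lower u = lower v :> nat by lia.
  have cE : #|[set w in N | before (dir w) v]| = #|[set w in N | before (dir w) u]| by lia.
  split; first by move: lE; case: (lower u); case: (lower v).
  move=> w wN.
  have /eqP/finset.setP/(_ w) :
      [set w in N | before (dir w) u] == [set w in N | before (dir w) v].
    by rewrite eqEcard sub cE /=.
  by rewrite !finset.inE wN.
move=> x0 y0 E.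
have [xy|nxy] := boolP (before x y); first exact: main.
have [yx|nyx] := boolP (before y x).
  have [|lE bE] := main _ _ y0 x0 yx; first by rewrite E.
  by split=> // w /bE.
have sxy : same_ray x y.
  move: nxy nyx; rewrite /before /same_ray.
  have -> : pdet y x = - pdet x y by rewrite /pdet; ring.
  rewrite oppr_gt0; case: (lower x); case: (lower y) => //=; by case: ltgtP.
by split=> [|w _]; [case/andP: sxy => /eqP|apply: same_ray_before].
Qed.

Lemma sector_le (V : finType) (N : {set V}) (dir : V -> plane) x :
  (sector N dir x <= #|N|.+1)%N.
Proof.
rewrite /sector -add1n leq_add ?leq_b1 //.
by apply: subset_leq_card; apply/fintype.subsetP => w; rewrite finset.inE => /andP[].
Qed.

Lemma sector_congr (V : finType) (N : {set V}) (dir : V -> plane) x y :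
  lower x = lower y -> (forall w, w \in N -> before (dir w) x = before (dir w) y) ->
  sector N dir x = sector N dir y.
Proof.
move=> lE bE; rewrite /sector lE; congr (_ + #|pred_of_set _|)%N.
by apply/finset.setP => w; rewrite !finset.inE; case: (boolP (w \in N)) => //= /bE.
Qed.
End Sectors.

(** * Shattered sets *)

Section Shattering.
Variable X : finType.
Implicit Types (F : {set {set X}}) (S T D : {set X}).

Definition shatters F S : bool :=
  [forall T : {set X}, (T \subset S) ==> [exists A in F, A :&: S == T]].

Lemma shattersP F S :
  reflect (forall T, T \subset S -> exists2 A, A \in F & A :&: S = T) (shatters F S).
Proof.
apply: (iffP forallP) => H T; first by
  move=> TS; have /existsP[A /andP[AF /eqP]] := implyP (H T) TS; exists A.
by apply/implyP => /H[A AF AS]; apply/existsP; exists A; rewrite AF AS eqxx.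
Qed.

(* Split [F] according to an element [x] that separates two of its members: a set
   shattered by both halves is still shattered after adding [x]. *)
Lemma pajor F : #|F| <= #|[set S | shatters F S]|.
Proof.
move: {2}#|F| (leqnn #|F|) => n; elim: n F => [|n IH] F; first by case: #|F|.
move=> Fn; have [F1|] := leqP #|F| 1.
  have [->|[A AF]] := set_0Vmem F; first by rewrite cards0.
  apply: leq_trans F1 _; rewrite card_gt0; apply/set0Pn; exists finset.set0.
  rewrite finset.inE; apply/shattersP => T; rewrite finset.subset0 => /eqP->.
  by exists A; rewrite ?finset.setI0.
case/card_gt1P => A [B [AF BF AB]].
have [x xAB] : exists x, (x \in A) != (x \in B).
  apply/existsP; apply: contraNT AB; rewrite negb_exists => /forallP H.
  by apply/eqP/finset.setP => x; have := H x; rewrite negbK => /eqP.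
pose G b := [set C in F | (x \in C) == b].
have FG : #|F| = (#|G true| + #|G false|)%N.
  rewrite -cardsUI; have -> : G true :&: G false = finset.set0.
    by apply/finset.setP => C; rewrite !finset.inE; case: (x \in C); rewrite ?andbF.
  rewrite cards0 addn0; congr #|pred_of_set _|; apply/finset.setP => C.
  by rewrite !finset.inE; case: (x \in C); rewrite ?andbT ?andbF ?orbF.
have G0 b : 0 < #|G b|.
  rewrite card_gt0; apply/set0Pn.
  have [eA|nA] := eqVneq (x \in A) b; first by exists A; rewrite finset.inE AF eA eqxx.
  exists B; rewrite finset.inE BF /=.
  by move: xAB nA; case: (x \in A); case: (x \in B); case: b.
have Gn b : #|G b| <= n.
  by have := G0 (~~ b); move: Fn; rewrite FG; case: b => /=; lia.
pose Sh b := [set S | shatters (G b) S].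
have ShF b S : S \in Sh b -> shatters F S.
  rewrite finset.inE => /shattersP H; apply/shattersP => T /H[C].
  by rewrite finset.inE => /andP[CF _] CT; exists C.
have Shx b S : S \in Sh b -> x \notin S.
  rewrite finset.inE => /shattersP H; apply/negP => xS.
  have [C] := H finset.set0 (finset.sub0set _).
  rewrite finset.inE => /andP[_ /eqP xC] CS.
  have [C'] := H S (subxx _); rewrite finset.inE => /andP[_ /eqP xC'] C'S.
  have : x \in C' by have : x \in C' :&: S; [rewrite C'S|rewrite finset.inE => /andP[]].
  rewrite xC' -xC => xC1; have : x \in C :&: S by rewrite finset.inE xC1.
  by rewrite CS finset.inE.
have ShU S : S \in Sh true :&: Sh false -> shatters F (x |: S).
  rewrite finset.inE => /andP[S1 S0]; have xS := Shx _ _ S1.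
  apply/shattersP => T TxS.
  have Sb : shatters (G (x \in T)) S.
    by case: (x \in T); [move: S1|move: S0]; rewrite finset.inE.
  have [|C] := (shattersP _ _ Sb) (T :\ x); first by rewrite finset.subDset.
  rewrite finset.inE => /andP[CF /eqP xC] CT; exists C => //.
  apply/finset.setP => y; rewrite !finset.inE.
  have [->|yx] := eqVneq y x; first by rewrite andbT.
  by have := congr1 (fun D : {set X} => y \in D) CT; rewrite !finset.inE yx.
have imI : #|[set x |: S | S in Sh true :&: Sh false]| = #|Sh true :&: Sh false|.
  apply: card_in_imset => S S' /finset.setIP[/Shx xS _] /finset.setIP[/Shx xS' _] E.
  by rewrite -(finset.setU1K xS) E finset.setU1K.
have disj : (Sh true :|: Sh false) :&: [set x |: S | S in Sh true :&: Sh false] = finset.set0.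
  apply/finset.setP => S; rewrite finset.inE finset.in_set0; apply/negP => /andP[SU].
  case/imsetP => S' _ E; have : x \in S by rewrite E finset.setU11.
  by apply/negP; case/finset.setUP: SU; apply: Shx.
apply: (@leq_trans (#|Sh true| + #|Sh false|)); first by rewrite FG leq_add ?IH.
rewrite -cardsUI -imI -cardsUI disj cards0 addn0; apply: subset_leq_card.
apply/fintype.subsetP => S /finset.setUP[/finset.setUP[]/ShF|/imsetP[S' /ShU ? ->]];
  by rewrite finset.inE.
Qed.

Lemma card_small_subsets D :
  #|[set S : {set X} | (S \subset D) && (#|S| <= 3)]| <= (#|D| ^ 3).+1.
Proof.
(* Triples with repetitions produce all sets of one to three elements; the empty set is responsible
   for the [.+1]. *)
pose f (t : X * X * X) : {set X} := [set t.1.1; t.1.2; t.2].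
pose D3 := finset.setX (finset.setX D D) D.
apply: (@leq_trans #|finset.set0 |: f @: D3|).
  apply: subset_leq_card; apply/fintype.subsetP => S; rewrite finset.inE => /andP[SD S3].
  have [->|[x xS]] := set_0Vmem S; first by rewrite finset.setU11.
  apply/finset.setUP; right.
  have xD s : s \in S -> s \in D by apply/fintype.subsetP.
  have memS s : s \in S = (s \in enum S) by rewrite mem_enum.
  move: S3; rewrite cardE; case E: (enum S) => [|a [|b [|c [|]]]] // _.
  - by rewrite memS E in xS.
  - have aD : a \in D by rewrite xD // memS E !seq.inE eqxx.
    apply/imsetP; exists (a, a, a); first by rewrite !finset.inE aD.
    by apply/finset.setP => s; rewrite memS E !finset.inE !orbb.
  - have aD : a \in D by rewrite xD // memS E !seq.inE eqxx.
    have bD : b \in D by rewrite xD // memS E !seq.inE eqxx orbT.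
    apply/imsetP; exists (a, b, b); first by rewrite !finset.inE aD bD.
    by apply/finset.setP => s; rewrite memS E !finset.inE -orbA orbb.
  have aD : a \in D by rewrite xD // memS E !seq.inE eqxx.
  have bD : b \in D by rewrite xD // memS E !seq.inE eqxx orbT.
  have cD : c \in D by rewrite xD // memS E !seq.inE eqxx !orbT.
  apply/imsetP; exists (a, b, c); first by rewrite !finset.inE aD bD cD.
  by apply/finset.setP => s; rewrite memS E !finset.inE orbA.
apply: leq_trans (leq_card_setU _ _) _; rewrite cards1 add1n ltnS.
apply: leq_trans (leq_imset_card _ _) _.
by rewrite !cardsX !expnS expn0 muln1 mulnA.
Qed.

Lemma shatter_bound F D : (forall A, A \in F -> A \subset D) ->
  (forall S, shatters F S -> #|S| <= 3) -> #|F| <= (#|D| ^ 3).+1.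
Proof.
move=> FD F3; apply: leq_trans (pajor F) _.
apply: leq_trans (card_small_subsets D); apply: subset_leq_card.
apply/fintype.subsetP => S; rewrite !finset.inE => SF; rewrite F3 // andbT.
have [A AF <-] := (shattersP _ _ SF) S (subxx _).
exact: fintype.subset_trans (finset.subsetIl _ _) (FD _ AF).
Qed.
End Shattering.

(** * Walks and links *)

Section Walks.
Variables (V : finType) (e : rel V).
Hypothesis e_sym : symmetric e.

(** Walks of bounded length replace [dist], because they can be reversed and concatenated without
    regard to minimality or infinite values; [dist_within] translates back. *)
Definition within (u v : V) (n : nat) : Prop :=
  exists p, [/\ path e u p, last u p = v & size p <= n].

Lemma within_sym u v n : within u v n -> within v u n.
Proof.
case=> p [ep <- sp]; exists (rev (belast u p)); split.
- by rewrite rev_path (eq_path (e' := e)) // => x y; exact: e_sym.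
- by case: p {ep sp} => // a p; rewrite /= rev_cons last_rcons.
- by rewrite size_rev size_belast.
Qed.

Lemma within_trans u v w m n : within u v m -> within v w n -> within u w (m + n).
Proof.
case=> p [ep <- sp] [q [eq lq sq]]; exists (p ++ q).
by rewrite cat_path last_cat size_cat ep eq lq leq_add.
Qed.

Lemma within_le u v m n : m <= n -> within u v m -> within u v n.
Proof. by move=> mn [p [ep lp sp]]; exists p; split=> //; apply: leq_trans mn. Qed.

Lemma within_has_path u v n : within u v n -> exists2 m, m <= n & has_path e u v m.
Proof.
case=> p [ep lp sp]; case: (shortenP ep) lp => q eq uq sub lq.
have sq : size q <= size p by apply: uniq_leq_size sub; case/andP: uq.
exists (size q); first exact: leq_trans sp.
by apply/existsP; exists (in_tuple q); apply/and3P; split=> //; apply/eqP.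
Qed.

Lemma has_path_within u v n : has_path e u v n -> within u v n.
Proof.
case/existsP => p /and3P[ep _ /eqP lp]; exists p; split=> //.
by rewrite size_tuple.
Qed.

Lemma dist_within u v n :
  (if dist e u v is Some m then m <= n else false) <-> within u v n.
Proof.
rewrite /dist; case: pselect => [uv|nuv]; last first.
  by split=> // /within_has_path[m _ um]; case: nuv; exists m.
case: ex_minnP => m um mP; split=> [mn|/within_has_path[k kn /mP mk]].
  exact: within_le (has_path_within um).
exact: leq_trans kn.
Qed.

Lemma profile_eq d (A : {set V}) v w :
  (forall a t, a \in A -> t <= d -> within v a t <-> within w a t) ->
  profile e d v A = profile e d w A.
Proof.
move=> H; apply/ffunP => -[a aA]; rewrite !ffunE /=.
have {}H t : t <= d -> (if dist e v a is Some m then m <= t else false) <->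
    (if dist e w a is Some m then m <= t else false).
  by move=> td; rewrite !dist_within; exact: H.
have ins m : d < m -> insub m = None :> option 'I_d.+1.
  by move=> dm; apply: insubN; rewrite ltnS -ltnNge.
case: (dist e v a) (dist e w a) H => [m|] [n|] //= H.
- have [md|dm] := leqP m d.
    have nm : n <= m by apply/(H m).
    have mn : m <= n by apply/(H n) => //; apply: leq_trans nm md.
    by congr insub; apply/eqP; rewrite eqn_leq mn.
  rewrite !ins //; rewrite ltnNge; apply/negP => nd.
  by have := leqnn n; move/(H n nd); rewrite leqNgt (leq_ltn_trans nd dm).
- have [md|dm] := leqP m d; last by rewrite ins.
  by have /(H m md) := leqnn m.
- have [md|dm] := leqP n d; last by rewrite ins.
  by have /(H n md) := leqnn n.
Qed.
End Walks.

Lemma card_bigcup_le (I T : finType) (A : {set I}) (F : I -> {set T}) :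
  #|\bigcup_(i in A) F i| <= \sum_(i in A) #|F i|.
Proof.
elim/big_rec2: _ => [|i n B _ IH]; first by rewrite cards0.
by apply: leq_trans (leq_card_setU _ _) _; rewrite leq_add2l.
Qed.

Section Links.
Variables (V : finType).

(** Linking all close pairs would take quadratically many walks. One parent per vertex, a neighbour
    nearer to the root of its component, keeps the number of links linear. *)
Lemma spanning_forest (r : rel V) : connect_sym r ->
  exists par : V -> V, (forall a, par a = a \/ r a (par a)) /\
  forall h : rel V, connect_sym h -> (forall a, connect h a (par a)) ->
  forall a b, connect r a b -> connect h a b.
Proof.
move=> r_sym.
have to_root a : exists n, [exists p : n.-tuple V, path r a p && (last a p == fingraph.root r a)].
  have /connectP[p rp lp] := connect_root r a.
  by exists (size p); apply/existsP; exists (in_tuple p); rewrite /= rp lp eqxx.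
pose N a := ex_minn (to_root a).
have step a : exists x, (x = a /\ fingraph.root r a = a) \/
    [/\ r a x, fingraph.root r x = fingraph.root r a & N x < N a].
  rewrite {2}/N; case: ex_minnP => -[|n] /existsP[p /andP[rp /eqP lp]] _.
    by exists a; left; split; rewrite // -lp (tuple0 p).
  case: p rp lp => -[|x p] //= sp /andP[rax rp] lp; exists x; right.
  have rx : fingraph.root r x = fingraph.root r a by apply/esym/(fingraph.rootP r_sym)/connect1.
  split=> //; rewrite /N; case: ex_minnP => m _; apply.
  have sp' : size p == n by [].
  by apply/existsP; exists (Tuple sp'); rewrite /= rp lp rx eqxx.
have [par parP] := choice step; exists par; split.
  by move=> a; case: (parP a) => [[]|[]]; auto.
move=> h h_sym hpar.
have hroot n a : N a < n -> connect h a (fingraph.root r a).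
  elim: n a => // n IH a; rewrite ltnS => Nan.
  case: (parP a) => [[_ ->]|[_ <- Nx]]; first exact: connect0.
  by apply: connect_trans (hpar a) (IH _ _); apply: leq_trans Nan.
move=> a b /(fingraph.rootP r_sym) ab.
apply: connect_trans (hroot _ _ (ltnSn _)) _; rewrite ab h_sym.
exact: hroot (ltnSn _).
Qed.

Variable e : rel V.
Hypotheses (e_sym : symmetric e).

(** The threshold [2 * d] serves twice: members of [A] within [d] of one vertex are within [2 * d]
    of each other, and each vertex on a link of that length is within [d] of an end of the link. The
    factor 4 arises because edges are counted as ordered pairs. *)
Lemma links (A : {set V}) (d : nat) :
  exists h : rel V, exists B : {set V}, [/\ symmetric h, subrel h e, A \subset B,
    forall u v, h u v -> u \in B &
    [/\ #|[set x : V * V | h x.1 x.2]| <= 4 * d * #|A|,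
    #|B| <= (2 * d).+1 * #|A|,
    forall a a', a \in A -> a' \in A -> within e a a' (2 * d) -> connect h a a' &
    forall b a, b \in B -> a \in A -> within e b a d -> connect h b a]].
Proof.
pose cl a a' := [&& a \in A, a' \in A & `[< within e a a' (2 * d) >]].
have cl_sym : symmetric cl.
  by move=> a b; apply/and3P/and3P => -[aA bA /asboolP H];
    split=> //; apply/asboolP; apply: within_sym.
have clc := sym_connect_sym cl_sym.
have [par [parP parh]] := spanning_forest clc.
have walk a : exists p, [/\ path e a p, last a p = par a & size p <= 2 * d].
  case: (parP a) => [->|/and3P[_ _ /asboolP//]]; by exists [::].
have [p pP] := choice walk.
have parA a : a \in A -> par a \in A.
  by case: (parP a) => [->|/and3P[]].
pose pairs a := zip (a :: p a) (p a).
pose h u v := [exists a in A, ((u, v) \in pairs a) || ((v, u) \in pairs a)].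
pose B := \bigcup_(a in A) [set x in a :: p a].
have h_sym : symmetric h.
  by move=> u v; apply/existsP/existsP => -[a]; rewrite orbC; exists a.
have hc := sym_connect_sym h_sym.
have zipP (g : rel V) x s : {subset zip (x :: s) s <= [pred y | g y.1 y.2]} <-> path g x s.
  elim: s x => [|y s IH] x //=; split.
    move=> H; have := H (x, y); rewrite !seq.inE eqxx => /(_ isT) /= -> /=.
    by apply/IH => z zs; apply: H; rewrite seq.inE zs orbT.
  by move=> /andP[xy /IH H] z; rewrite seq.inE => /orP[/eqP->//|/H].
have he : subrel h e.
  move=> u v /existsP[a /andP[_]]; have [ep _ _] := pP a.
  have H := (zipP e a (p a)).2 ep.
  by case/orP => /H; rewrite finset.inE //= e_sym.
have hpath a : a \in A -> path h a (p a).
  move=> aA; apply/zipP => -[u v] uv; rewrite finset.inE /=; apply/existsP; exists a.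
  by rewrite aA uv.
have hcon a b : a \in A -> b \in a :: p a -> connect h a b.
  by move=> aA; apply: path_connect; exact: hpath.
have hpar a : connect h a (par a).
  have [aA|aA] := boolP (a \in A).
    by have [_ <- _] := pP a; apply: hcon => //; exact: mem_last.
  case: (parP a) => [->|]; first exact: connect0.
  by rewrite /cl (negPf aA).
have hA a a' : a \in A -> a' \in A -> within e a a' (2 * d) -> connect h a a'.
  move=> aA aA' w; apply: parh => //; apply: connect1; apply/and3P; split=> //.
  exact/asboolP.
exists h, B; split=> //.
- by apply/fintype.subsetP => a aA; apply/bigcupP; exists a; rewrite // finset.inE mem_head.
- move=> u v /existsP[a /andP[aA uv]]; apply/bigcupP; exists a => //.
  have memz x s : (u, v) \in zip (x :: s) s -> u \in x :: s.
    elim: s x => [|z s IH] x //=; rewrite seq.inE => /orP[/eqP[-> _]|/IH].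
      exact: mem_head.
    by move=> uzs; rewrite in_cons uzs orbT.
  have memz' x s : (v, u) \in zip (x :: s) s -> u \in x :: s.
    elim: s x => [|z s IH] x //=; rewrite seq.inE => /orP[/eqP[_ ->]|/IH].
      by rewrite !seq.inE eqxx orbT.
    by move=> uzs; rewrite in_cons uzs orbT.
  by rewrite finset.inE; case/orP: uv => [/memz|/memz'].
split=> //.
- pose Q a := [set x in pairs a] :|: [set x in [seq (y.2, y.1) | y <- pairs a]].
  apply: (@leq_trans #|\bigcup_(a in A) Q a|).
    apply: subset_leq_card; apply/fintype.subsetP => -[u v].
    rewrite finset.inE /= => /existsP[a /andP[aA uv]]; apply/bigcupP; exists a => //.
    rewrite !finset.inE; case/orP: uv => [->//|vu]; apply/orP; right.
    by apply/mapP; exists (v, u).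
  apply: leq_trans (card_bigcup_le _ _) _.
  rewrite mulnC -sum_nat_const; apply: leq_sum => a _.
  have [_ _ sp] := pP a.
  have szp : size (pairs a) <= 2 * d
    by rewrite /pairs size_zip /=; apply: leq_trans (geq_minr _ _) sp.
  apply: leq_trans (leq_card_setU _ _) _.
  have -> : 4 * d = 2 * d + 2 * d by lia.
  apply: leq_add; rewrite cardsE; apply: leq_trans (card_size _) _ => //.
  by rewrite size_map.
- apply: leq_trans (card_bigcup_le _ _) _.
  rewrite mulnC -sum_nat_const; apply: leq_sum => a _.
  have [_ _ sp] := pP a; rewrite cardsE; apply: leq_trans (card_size _) _.
  by rewrite /= ltnS.
- move=> b a /bigcupP[a0 a0A]; rewrite finset.inE => ba0 aA wba.
  have [ep lp sp] := pP a0.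
  have hb : connect h b a0 by rewrite hc; exact: hcon.
  apply: connect_trans hb _.
  (* Of the two parts into which [b] cuts a link of length at most [2 * d], one has length at most
     [d]. *)
  have [wb|wb] : within e a0 b d \/ within e b (par a0) d.
    case/splitPl: ba0 ep lp sp => p1 p2 lb.
    rewrite cat_path last_cat size_cat lb => /andP[ep1 ep2] lp sp.
    have [s1|s1] := leqP (size p1) d; first by left; exists p1.
    right; exists p2; split=> //; rewrite -(leq_add2l (size p1)).
    by apply: leq_trans sp _; rewrite mul2n -addnn leq_add2r ltnW.
  - apply: hA => //; rewrite mul2n -addnn; exact: within_trans wb wba.
  - apply: connect_trans (hpar a0) _; apply: hA => //; first exact: parA.
    by rewrite mul2n -addnn; apply: within_trans wba; apply: within_sym.
Qed.
End Links.

(** * Connected sets in a plane drawing *)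

Section Webs.
Variable R : realType.
Local Open Scope classical_set_scope.
Local Open Scope ring_scope.
Notation plane := (R * R)%type.

Definition seg (p q : plane) : set plane := [set comb t p q | t in `[0, 1]].

Lemma seg_image_continuous (p q : plane) :
  {within `[(0 : R), 1], continuous (fun t => comb t p q)}.
Proof.
apply: continuous_subspaceT => t.
have c (a b : R) : (fun t => (1 - t) * a + t * b) @ t --> (1 - t) * a + t * b.
  apply: cvgD; apply: cvgM; try exact: cvg_cst; try exact: cvg_id.
  by apply: cvgB; [exact: cvg_cst|exact: cvg_id].
exact: cvg_pair (c p.1 q.1) (c p.2 q.2).
Qed.

Lemma seg_compact (p q : plane) : compact (seg p q).
Proof.
by apply: continuous_compact; [exact: seg_image_continuous|exact: segment_compact].
Qed.

Lemma seg_connected (p q : plane) : connected (seg p q).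
Proof.
apply: connected_continuous_connected; first exact: segment_connected.
exact: seg_image_continuous.
Qed.

Lemma seg_left (p q : plane) : seg p q p.
Proof. by exists 0; rewrite ?comb0 //= bound_itvE. Qed.

Lemma seg_right (p q : plane) : seg p q q.
Proof. by exists 1; rewrite ?comb1 //= bound_itvE. Qed.

Lemma segP (p q z c : plane) : seg p q z ->
  exists2 t, 0 <= t <= 1 & z - c = comb t (p - c) (q - c).
Proof. by case=> t /=; rewrite in_itv /= => t01 <-; exists t; rewrite ?combB. Qed.

Lemma seg_norm (p q z c : plane) r : `|p - c| <= r -> `|q - c| <= r -> seg p q z ->
  `|z - c| <= r.
Proof. by move=> pc qc /(segP c)[t t01 ->]; apply: comb_norm. Qed.

Lemma bigcup_pred_compact (T : topologicalType) (I : finType) (P : {pred I})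
    (F : I -> set T) :
  (forall i, i \in P -> compact (F i)) -> compact (\bigcup_(i in [set` P]) F i).
Proof. by move=> cF; rewrite bigcup_pred; apply: bigsetU_compact. Qed.

Lemma connected_from (T : topologicalType) (A : set T) (x : T) : A x ->
  (forall y, A y -> connected_component A x y) -> connected A.
Proof.
move=> Ax H; suff -> : A = connected_component A x by exact: component_connected.
by apply/seteqP; split=> //; exact: connected_component_sub.
Qed.

Lemma connected_component_of (T : topologicalType) (A C : set T) (x y : T) :
  connected C -> C `<=` A -> C x -> C y -> connected_component A x y.
Proof. by move=> cC CA Cx Cy; exact: (connected_component_max Cx CA cC Cy). Qed.

Variables (V : finType) (e : rel V) (pt : V -> plane) (r : R)
  (q : V -> V -> plane) (T : V -> V -> set plane).
Hypotheses (cd : clean_drawing e pt r q T) (e_sym : symmetric e) (e_irr : irreflexive e).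
Implicit Types (g : rel V) (U : {set V}).

(** The spokes go to all [g]-neighbours, even those outside the vertex set of a web; a web thus
    contains the exit points at which tails are attached. *)
Definition star g u : set plane :=
  [set pt u] `|` \bigcup_(w in [set` g u]) seg (pt u) (q u w).

Definition web g U : set plane :=
  \bigcup_(u in [set` U])
    (star g u `|` \bigcup_(w in [set` [pred w | (w \in U) && g u w]]) T u w).

Lemma webP g U z : web g U z ->
  (exists2 u, u \in U & star g u z) \/
  exists u w, [/\ u \in U, w \in U, g u w & T u w z].
Proof.
case=> u uU [|[w /andP[wU uw]]]; first by left; exists u.
by right; exists u, w.
Qed.

Lemma star_web g U u : u \in U -> star g u `<=` web g U.
Proof. by move=> uU z uz; exists u => //; left. Qed.

Lemma web_edge g U u w : u \in U -> w \in U -> g u w -> T u w `<=` web g U.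
Proof. by move=> uU wU uw z Tz; exists u => //; right; exists w => //; exact/andP. Qed.

Lemma starP g u z : star g u z ->
  z = pt u \/ exists2 w, g u w & seg (pt u) (q u w) z.
Proof. by case=> [->|[w uw uz]]; [left|right; exists w]. Qed.

Lemma star_pt g u : star g u (pt u). Proof. by left. Qed.

Lemma star_exit g u w : g u w -> star g u (q u w).
Proof. by move=> uw; right; exists w => //; exact: seg_right. Qed.

Lemma star_compact g u : compact (star g u).
Proof.
apply: compactU; first exact: compact_set1.
by apply: bigcup_pred_compact => w _; exact: seg_compact.
Qed.

Lemma star_connected g u : connected (star g u).
Proof.
apply: (@connected_from _ _ (pt u)); first exact: star_pt.
move=> z /starP[->|[w uw uz]]; first by apply: connected_component_refl; exact: star_pt.
apply: connected_component_of (@seg_connected (pt u) (q u w)) _ _ _ => //.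
  by move=> y uy; right; exists w.
exact: seg_left.
Qed.

Lemma star_ball g u z : subrel g e -> star g u z -> `|z - pt u| <= r.
Proof.
have r0 := ltW (cd_r0 cd).
move=> ge /starP[->|[w /ge uw]]; first by rewrite subrr normr0.
by apply: seg_norm; rewrite ?subrr ?normr0 // (cd_exit cd uw).
Qed.

Lemma web_compact g U : subrel g e -> compact (web g U).
Proof.
move=> ge; apply: bigcup_pred_compact => u uU.
apply: compactU; first exact: star_compact.
by apply: bigcup_pred_compact => w /andP[_ /ge uw]; exact: (cd_compact cd uw).
Qed.

Lemma web_connected g U u0 : subrel g e -> symmetric g -> u0 \in U ->
  (forall u, u \in U -> exists p, [/\ path g u0 p, last u0 p = u &
     {subset u0 :: p <= U}]) ->
  connected (web g U).
Proof.
move=> ge gs u0U conn.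
pose comp := connected_component (web g U).
have step u w : u \in U -> w \in U -> g u w -> comp (pt u) (pt w).
  move=> uU wU uw; have euw := ge _ _ uw.
  apply: (@connected_component_of _ _ (star g u `|` T u w `|` star g w)).
  - apply: connectedU; [|apply: connectedU|exact: star_connected].
    + exists (q w u); split; last by apply: star_exit; rewrite gs.
      by right; rewrite (cd_sym cd); apply: (cd_end cd); rewrite e_sym.
    + by exists (q u w); split; [exact: star_exit|exact: (cd_end cd)].
    + exact: star_connected.
    + exact: (cd_connected cd euw).
  - by move=> z [[]|]; [exact: star_web|exact: web_edge|exact: star_web].
  - by left; left; exact: star_pt.
  - by right; exact: star_pt.
have reach u : u \in U -> comp (pt u0) (pt u).
  case/conn => p [+ <-]; elim: p u0 u0U {conn} => [|x p IH] y yU /=.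
    by move=> _ _; apply: connected_component_refl; apply: (star_web yU); exact: star_pt.
  move=> /andP[yx xp] sub; have xU : x \in U by apply: sub; rewrite seq.inE mem_head orbT.
  apply: connected_component_trans (step _ _ yU xU yx) _.
  by apply: IH => // z zp; apply: sub; rewrite in_cons zp orbT.
apply: (@connected_from _ _ (pt u0)); first by apply: (star_web u0U); exact: star_pt.
move=> z /webP[[u uU uz]|[u [w [uU wU uw Tz]]]].
  apply: connected_component_trans (reach _ uU) _.
  exact: (connected_component_of (@star_connected g u) (@star_web g U u uU) (star_pt g u) uz).
apply: connected_component_trans (reach _ uU) _.
apply: (@connected_component_of _ _ (star g u `|` T u w)).
- apply: connectedU; [|exact: star_connected|exact: (cd_connected cd (ge _ _ uw))].
  by exists (q u w); split; [exact: star_exit|exact: (cd_end cd (ge _ _ uw))].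
- by move=> y []; [exact: star_web|exact: web_edge].
- by left; exact: star_pt.
- by right.
Qed.

Lemma ball_disjoint u v z : u != v -> `|z - pt u| <= r -> `|z - pt v| <= r -> False.
Proof. by move=> uv zu zv; have := cd_ball cd uv zu; rewrite ltNge zv. Qed.

Lemma edge_ball u v w z : e u v -> w != u -> w != v -> T u v z ->
  `|z - pt w| <= r -> False.
Proof. by move=> uv wu wv Tz zw; have := cd_avoid cd uv Tz wu wv; rewrite ltNge zw. Qed.

Lemma edges_disjoint u v x y z : e u v -> e x y -> u != x -> u != y ->
  T u v z -> T x y z -> False.
Proof.
move=> uv xy ux uy; apply: (cd_disj cd uv xy).
apply/eqP => /finset.setP/(_ u); rewrite !finset.inE eqxx /=.
by rewrite (negPf ux) (negPf uy).
Qed.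

Lemma webs_disjoint g g' U U' : subrel g e -> subrel g' e ->
  (forall u, u \in U -> u \notin U') -> web g U `&` web g' U' = set0.
Proof.
move=> ge ge' UU'; have neq u u' : u \in U -> u' \in U' -> u != u'.
  by move=> uU; apply: contraTneq => <-; exact: UU'.
apply/seteqP; split=> // z [].
case/webP => [[u uU /(star_ball ge) uz]|[u [w [uU wU /ge uw Tz]]]].
  case/webP => [[u' uU' /(star_ball ge') uz']|[u' [w' [uU' wU' /ge' uw' Tz']]]].
    exact: ball_disjoint (neq _ _ uU uU') uz uz'.
  exact: edge_ball uw' (neq _ _ uU uU') (neq _ _ uU wU') Tz' uz.
case/webP => [[u' uU' /(star_ball ge') uz']|[u' [w' [uU' wU' /ge' uw' Tz']]]].
  by apply: edge_ball uw _ _ Tz uz'; rewrite eq_sym; apply: neq.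
exact: edges_disjoint uw uw' (neq _ _ uU uU') (neq _ _ uU wU') Tz Tz'.
Qed.
End Webs.

(** * Approaching a vertex inside one sector *)

Section Tails.
Variable R : realType.
Local Open Scope classical_set_scope.
Local Open Scope ring_scope.
Notation plane := (R * R)%type.
Variables (V : finType) (e : rel V) (pt : V -> plane) (r : R)
  (q : V -> V -> plane) (T : V -> V -> set plane).
Hypotheses (cd : clean_drawing e pt r q T) (e_sym : symmetric e) (e_irr : irreflexive e).
Variables (h : rel V) (B : {set V}).
Hypotheses (h_sym : symmetric h) (he : subrel h e) (hB : forall u v, h u v -> u \in B).
Implicit Types (g : rel V) (U : {set V}) (b w x u : V) (z : plane).

Notation star := (star pt q).
Notation web := (web pt q T).

(* [h] is the subgraph of [G] containing the given vertices; its edges at [b] cut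
   the disc of [b] into sectors. *)
Definition dir b w : plane := q b w - pt b.
Definition sec b z : nat := sector [set y | h b y]%SET (dir b) (z - pt b).

Lemma dir_neq0 b w : e b w -> dir b w != 0.
Proof. by move=> bw; rewrite -normr_gt0 /dir (cd_exit cd bw) (cd_r0 cd). Qed.

(** Exits from one disc have equal norm, so two of them on one ray coincide, and two distinct
    trimmed edges would share this point. *)
Lemma ray_free b w y : e b w -> w \notin B -> h b y -> ~~ same_ray (dir b y) (dir b w).
Proof.
move=> bw wB hby; have yB : y \in B by apply: (hB (v := b)); rewrite h_sym.
have yw : y != w by apply: contraNneq wB => <-.
apply/negP => ray.
have qE : q b y = q b w.
  apply: (addIr (- pt b)).
  apply: (same_ray_norm (dir_neq0 (he hby)) (dir_neq0 bw) ray).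
  by rewrite /dir (cd_exit cd bw) (cd_exit cd (he hby)).
have yb : y != b by apply: contraTneq (he hby) => ->; rewrite e_irr.
apply: (edges_disjoint cd (u := y) (v := b) (x := w) (y := b) (z := q b y)) => //.
- by rewrite e_sym he.
- by rewrite e_sym.
- by rewrite (cd_sym cd); apply: (cd_end cd); exact: he.
- by rewrite qE (cd_sym cd); apply: (cd_end cd).
Qed.

(** Sectors are convex, and by [ray_free] neither end lies on a ray of [h]; so the segment between
    them misses every spoke of [h] at [b]. *)
Lemma seg_sec b w x z : e b w -> e b x -> w \notin B -> x \notin B ->
    sec b (q b w) = sec b (q b x) -> seg (q b w) (q b x) z ->
  [/\ z != pt b, sec b z = sec b (q b x), `|z - pt b| <= r & ~ star h b z].
Proof.
move=> bw bx wB xB swx zwx.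
have dw0 := dir_neq0 bw; have dx0 := dir_neq0 bx.
have dir0 y : y \in [set y | h b y]%SET -> dir b y != 0.
  by rewrite finset.inE => /he; exact: dir_neq0.
have [lE bE] := sector_eq dir0 dw0 dx0 swx.
have [t t01 zE] := segP (pt b) zwx.
have [z0 lz] := comb_lower t01 dw0 dx0 lE.
have bz y : h b y -> before (dir b y) (z - pt b) = before (dir b y) (dir b w).
  by move=> hby; rewrite zE comb_before // bE // finset.inE.
split.
- by rewrite -subr_eq0 zE.
- rewrite -swx; apply: sector_congr; first by rewrite zE.
  by move=> y; rewrite finset.inE; exact: bz.
- by apply: seg_norm zwx; rewrite (cd_exit cd).
have nray y : h b y -> ~~ same_ray (dir b y) (z - pt b).
  move=> hby; rewrite zE; apply: comb_same_ray => //; try exact: ray_free.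
  by apply: bE; rewrite finset.inE.
case/starP => [zb|[y hby /(segP (pt b))[s /andP[s0 s1]]]].
  by move: z0; rewrite -zE zb subrr eqxx.
rewrite subrr => zy; have := nray _ hby.
have [s_0|sn0] := eqVneq s 0.
  by move: z0; rewrite -zE zy s_0 comb0 eqxx.
by rewrite zy same_ray_scale // lt_neqAle eq_sym sn0.
Qed.

Lemma ray_sec b x z : e b x -> seg (pt b) (q b x) z ->
  `|z - pt b| <= r /\ (z = pt b \/ sec b z = sec b (q b x)).
Proof.
move=> bx zx; have r0 := ltW (cd_r0 cd); split.
  by apply: seg_norm zx; rewrite ?subrr ?normr0 // (cd_exit cd).
have [t /andP[t0 t1]] := segP (pt b) zx; rewrite subrr => zE.
have [t_0|tn0] := eqVneq t 0.
  by left; apply/eqP; rewrite -subr_eq0 zE t_0 comb0.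
right; have {}t0 : 0 < t by rewrite lt_neqAle eq_sym tn0.
have dx0 := dir_neq0 bx.
have ray := same_ray_scale (dir b x) t0.
apply: sector_congr; first by rewrite zE; case/andP: ray => /eqP.
move=> y _; rewrite zE; apply/esym/same_ray_before => //.
exact: scale_neq0.
Qed.

(** Inside the disc of [b] the edge is bent towards a chosen exit [q b x] of the same sector, so
    that all paths into this sector end at one point. *)
Definition tail b w x : set plane := T w b `|` seg (q b w) (q b x).

Record tail_ok b w x : Prop := {
  to_w : e b w; to_x : e b x; to_b : b \in B; to_wB : w \notin B; to_xB : x \notin B;
  to_sec : sec b (q b w) = sec b (q b x) }.

Lemma to_wb b w x : tail_ok b w x -> e w b. Proof. by rewrite e_sym => /to_w. Qed.
Lemma to_neq b w x u : tail_ok b w x -> u \in B -> w != u.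
Proof. by move=> /to_wB wB; apply: contraTneq => <-. Qed.

Lemma tail_compact b w x : tail_ok b w x -> compact (tail b w x).
Proof.
by move=> ok; apply: compactU; [exact: (cd_compact cd (to_wb ok))|exact: seg_compact].
Qed.

Lemma tail_mid b w x : tail_ok b w x -> T w b (q b w).
Proof. by move=> ok; rewrite (cd_sym cd); apply: (cd_end cd); exact: to_w ok. Qed.

Lemma tail_connected b w x : tail_ok b w x -> connected (tail b w x).
Proof.
move=> ok; apply: connectedU; [|exact: (cd_connected cd (to_wb ok))|exact: seg_connected].
by exists (q b w); split; [exact: tail_mid ok|exact: seg_left].
Qed.

Lemma tail_start b w x : tail_ok b w x -> tail b w x (q w b).
Proof. by move=> ok; left; exact: (cd_end cd (to_wb ok)). Qed.

Lemma tail_end b w x : tail b w x (q b x).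
Proof. by right; exact: seg_right. Qed.

Lemma edge_exit b w z : e w b -> T w b z -> `|z - pt b| <= r -> z = q b w.
Proof. by move=> wb; rewrite (cd_sym cd); apply: (cd_exitP cd); rewrite e_sym. Qed.

(** The trimmed edge avoids the discs of vertices other than its ends and touches that of [b] only
    at [q b w], where the segment starts; so [seg_sec] describes all that can happen. *)
Lemma tail_ball b w x z u : tail_ok b w x -> tail b w x z -> u != w ->
    `|z - pt u| <= r ->
  [/\ u = b, z != pt b, sec b z = sec b (q b x) & ~ star h b z].
Proof.
move=> ok tz uw zu.
have seg_b y := @seg_sec b w x y (to_w ok) (to_x ok) (to_wB ok) (to_xB ok) (to_sec ok).
have [ub|ub] := eqVneq u b; last first.
  case: tz => [Tz|/seg_b[_ _ zb _]]; exfalso.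
    exact: (edge_ball cd (to_wb ok) uw ub Tz zu).
  exact: (ball_disjoint cd ub zu zb).
suff /seg_b[] : seg (q b w) (q b x) z by split.
case: tz => // Tz; rewrite (edge_exit (to_wb ok) Tz) -?ub //; exact: seg_left.
Qed.

Lemma tail_edge b w x u v z : tail_ok b w x -> w != u -> w != v -> e u v ->
  tail b w x z -> T u v z -> (u = b \/ v = b) /\ seg (q b w) (q b x) z.
Proof.
move=> ok wu wv uv [Tz|sz] Tz'.
  by have := edges_disjoint cd (to_wb ok) uv wu wv Tz Tz'.
split=> //.
have [_ _ zb _] := seg_sec (to_w ok) (to_x ok) (to_wB ok) (to_xB ok) (to_sec ok) sz.
have [->|ub] := eqVneq u b; first by left.
have [->|vb] := eqVneq v b; first by right.
by exfalso; apply: (edge_ball cd uv _ _ Tz' zb); rewrite eq_sym.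
Qed.

Lemma tail_web g U b w x : subrel g e -> tail_ok b w x -> b \notin U -> w \notin U ->
  tail b w x `&` web g U = set0.
Proof.
move=> ge ok bU wU; apply/seteqP; split=> // z [tz].
have neq u y : u \notin U -> y \in U -> u != y by move=> uU; apply: contraTneq => <-.
case/webP => [[u uU /(star_ball cd ge) uz]|[u [v [uU vU /ge uv Tz]]]].
  have uw : u != w by rewrite eq_sym neq.
  by have [ub _ _ _] := tail_ball ok tz uw uz; move: bU; rewrite -ub uU.
have [[ub|vb] _] := tail_edge ok (neq _ _ wU uU) (neq _ _ wU vU) uv tz Tz.
  by move: bU; rewrite -ub uU.
by move: bU; rewrite -vb vU.
Qed.

(** The segment could meet a trimmed edge of [h] only at an exit from the disc of [b]; such an exit
    is on the star of [b], which [seg_sec] excludes. *)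
Lemma tail_hweb (C : {set V}) b w x : C \subset B -> tail_ok b w x ->
  tail b w x `&` web h C = set0.
Proof.
move=> /fintype.subsetP CB ok; apply/seteqP; split=> // z [tz].
have neq y : y \in C -> w != y by move=> yC; apply: (to_neq ok); exact: CB.
case/webP => [[u uU uz]|[u [v [uU vU huv Tz]]]].
  have uw : u != w by rewrite eq_sym neq.
  have [ub _ _ nz] := tail_ball ok tz uw (star_ball cd he uz).
  by apply: nz; rewrite -ub.
have [ubvb sz] := tail_edge ok (neq _ uU) (neq _ vU) (he huv) tz Tz.
have [_ _ zb] := seg_sec (to_w ok) (to_x ok) (to_wB ok) (to_xB ok) (to_sec ok) sz.
apply; case: ubvb => ub; move: huv Tz; rewrite ub => huv Tz.
  by rewrite (cd_exitP cd (he huv) Tz zb); exact: star_exit.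
rewrite h_sym in huv; rewrite (cd_sym cd) in Tz.
by rewrite (cd_exitP cd (he huv) Tz zb); exact: star_exit.
Qed.

Lemma tails_disjoint b w x b' w' x' : tail_ok b w x -> tail_ok b' w' x' ->
  w != w' -> (b = b' -> sec b (q b x) <> sec b' (q b' x')) ->
  tail b w x `&` tail b' w' x' = set0.
Proof.
move=> ok ok' ww' bb'; apply/seteqP; split=> // z [tz tz'].
case: (tz') => [Tz|sz].
  have [bE sz] := tail_edge ok ww' (to_neq ok (to_b ok')) (to_wb ok') tz Tz.
  have [_ _ zb _] := seg_sec (to_w ok) (to_x ok) (to_wB ok) (to_xB ok) (to_sec ok) sz.
  have bw' : b != w' by rewrite eq_sym (to_neq ok') // (to_b ok).
  have [bE' _ s' _] := tail_ball ok' tz' bw' zb.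
  have bw : b != w by rewrite eq_sym (to_neq ok) // (to_b ok).
  have [_ _ s _] := tail_ball ok tz bw zb.
  by apply: (bb' bE'); rewrite -s -s' bE'.
have [_ s' zb' _] := seg_sec (to_w ok') (to_x ok') (to_wB ok') (to_xB ok') (to_sec ok') sz.
have bw : b' != w by rewrite eq_sym (to_neq ok) // (to_b ok').
have [bE _ s _] := tail_ball ok tz bw zb'.
by apply: bb'; rewrite -?s -?s' bE.
Qed.

Lemma ray_tail_disjoint b x b' w' x' : e b x -> b \in B -> tail_ok b' w' x' ->
  (b = b' -> sec b (q b x) <> sec b' (q b' x')) ->
  tail b' w' x' `&` seg (pt b) (q b x) = set0.
Proof.
move=> bx bB ok bb'; apply/seteqP; split=> // z [tz /(ray_sec bx)[zb zs]].
have bw : b != w' by rewrite eq_sym (to_neq ok).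
have [bE z0 s _] := tail_ball ok tz bw zb.
case: zs => [zpt|zs]; first by move: z0; rewrite zpt bE eqxx.
by apply: (bb' bE); rewrite -s -zs bE.
Qed.

Lemma ray_web_disjoint g U b x : subrel g e -> e b x -> b \notin U ->
  web g U `&` seg (pt b) (q b x) = set0.
Proof.
move=> ge bx bU; apply/seteqP; split=> // z [wz /(ray_sec bx)[zb _]].
have neq y : y \in U -> b != y by apply: contraTneq => <-.
case/webP: wz => [[u uU /(star_ball cd ge) uz]|[u [v [uU vU /ge uv Tz]]]].
  exact: (ball_disjoint cd (neq _ uU) zb uz).
exact: (edge_ball cd uv (neq _ uU) (neq _ vU) Tz zb).
Qed.
End Tails.

(** * First hits of a subgraph *)

Lemma disjoint_setUl (T : Type) (A B C : set T) :
  (A `&` C = set0 -> B `&` C = set0 -> (A `|` B) `&` C = set0)%classic.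
Proof. by move=> A0 B0; rewrite setIUl A0 B0 setU0. Qed.

Lemma disjoint_setUr (T : Type) (A B C : set T) :
  (A `&` B = set0 -> A `&` C = set0 -> A `&` (B `|` C) = set0)%classic.
Proof. by move=> B0 C0; rewrite setIUr B0 C0 setU0. Qed.

Section Reach.
Variable R : realType.
Local Open Scope classical_set_scope.
Notation plane := (R * R)%type.
Variables (V : finType) (e : rel V) (pt : V -> plane) (r : R)
  (q : V -> V -> plane) (T : V -> V -> set plane).
Hypotheses (cd : clean_drawing e pt r q T) (e_sym : symmetric e) (e_irr : irreflexive e).
Variables (h : rel V) (B : {set V}).
Hypotheses (h_sym : symmetric h) (he : subrel h e) (hB : forall u v, h u v -> u \in B).

Notation star := (star pt q).
Notation web := (web pt q T).
Notation sec := (sec pt q h).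
Notation tail := (tail q T).
Notation tail_ok := (tail_ok e pt q h B).

(* [rpath v b n p]: [p] stays outside [B] and its last vertex sends an edge to [b]
   through the sector [n] of [b]. *)
Definition rpath v b n p :=
  [/\ path e v p, all [predC B] (v :: p), e b (last v p) & sec b (q b (last v p)) = n].

Definition reach v b n k : Prop := exists2 p, rpath v b n p & size p < k.

Lemma reach_le v b n k k' : k <= k' -> reach v b n k -> reach v b n k'.
Proof. by move=> kk' [p rp pk]; exists p => //; apply: leq_trans kk'. Qed.

(** Whichever path arrives at [u] after fewer steps continues along the rest of the other, without
    exceeding the length of that other path. *)
Lemma reach_exchange v b n k p v' b' n' k' p' u :
    rpath v b n p -> size p < k -> u \in v :: p ->
    rpath v' b' n' p' -> size p' < k' -> u \in v' :: p' ->
  reach v b' n' k' \/ reach v' b n k.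
Proof.
move=> rp pk up rp' pk' up'.
case/splitPl: up rp pk => p1 p2 l1 [+ + +]; case/splitPl: up' rp' pk' => q1 q2 l2 [+ + +].
rewrite !last_cat !cat_path -!cat_cons !all_cat !size_cat l1 l2.
move=> /andP[eq1 eq2] /andP[aq1 aq2] eb' <- sq /andP[ep1 ep2] /andP[ap1 ap2] eb <- sp.
have [le|lt] := leqP (size p1) (size q1); [left; exists (p1 ++ q2)|right; exists (q1 ++ p2)].
- by split; rewrite ?cat_path ?last_cat -?cat_cons ?all_cat ?l1 ?ep1 ?ap1.
- by rewrite size_cat; apply: leq_ltn_trans sq; rewrite leq_add2r.
- by split; rewrite ?cat_path ?last_cat -?cat_cons ?all_cat ?l2 ?eq1 ?aq1.
- by rewrite size_cat; apply: leq_ltn_trans sp; rewrite leq_add2r ltnW.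
Qed.

Variables (b : nat -> V) (n m : nat -> nat) (v : nat -> nat -> V).
Hypotheses (bB : forall i, i < 4 -> b i \in B)
  (reachE : forall i j k, i < 4 -> j < 4 -> k < 4 ->
     reach (v i j) (b k) (n k) (m k) <-> k = i \/ k = j)
  (b_conn : forall i, i < 4 -> connect h (b 0) (b i)).

(** Cells with the same vertex and sector differ only in their bound; the witness that reaches only
    the cell with the smaller bound would then reach the other too. *)
Lemma cells_distinct i j : i < 4 -> j < 4 -> i <> j -> b i = b j -> n i <> n j.
Proof.
move=> i4 j4 ij bij nij; have [mij|/ltnW mji] := leqP (m i) (m j).
  have : reach (v i i) (b i) (n i) (m i) by apply/reachE; auto.
  by move=> /(reach_le mij); rewrite bij nij => /reachE[]// /esym.
have : reach (v j j) (b j) (n j) (m j) by apply/reachE; auto.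
by move=> /(reach_le mji); rewrite -bij -nij => /reachE[].
Qed.

(* A K5 whose first four vertices lie in the given sectors, the edges between them
   running through the [v i j]; the fifth vertex is a component of [h]. *)
Lemma reach_false : False.
Proof.
have paths (t : nat * nat * nat) : exists p, t.1.1 < 4 -> t.1.2 < 4 ->
    (t.2 = t.1.1 \/ t.2 = t.1.2) ->
    rpath (v t.1.1 t.1.2) (b t.2) (n t.2) p /\ size p < m t.2.
  have [H|H] := pselect [/\ t.1.1 < 4, t.1.2 < 4 & t.2 = t.1.1 \/ t.2 = t.1.2].
    have [i4 j4 ijk] := H; have k4 : t.2 < 4 by case: ijk => ->.
    by have [p rp sp] := (reachE i4 j4 k4).2 ijk; exists p.
  by exists [::] => i4 j4 ijk; case: H.
have [P0 P0P] := choice paths.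
pose P i j k := P0 (i, j, k).
have PP i j k : i < 4 -> j < 4 -> k = i \/ k = j ->
    rpath (v i j) (b k) (n k) (P i j k) /\ size (P i j k) < m k.
  exact: P0P (i, j, k).
pose w i j k := last (v i j) (P i j k).
(* The witness of the singleton [k] fixes the common endpoint of all tails into the sector [k]. *)
pose x k := w k k k.
have wP i j k : i < 4 -> j < 4 -> k = i \/ k = j ->
    [/\ e (b k) (w i j k), w i j k \notin B & sec (b k) (q (b k) (w i j k)) = n k].
  move=> i4 j4 ijk; have [[_ /allP aB eb sb] _] := PP _ _ _ i4 j4 ijk.
  by split=> //; have := aB _ (mem_last _ _).
have xP k : k < 4 ->
    [/\ e (b k) (x k), x k \notin B & sec (b k) (q (b k) (x k)) = n k].
  by move=> k4; apply: wP; auto.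
have ok i j k : i < 4 -> j < 4 -> k = i \/ k = j -> tail_ok (b k) (w i j k) (x k).
  move=> i4 j4 ijk; have k4 : k < 4 by case: ijk => ->.
  have [ew wB sw] := wP _ _ _ i4 j4 ijk; have [ex xB sx] := xP _ k4.
  by split=> //; [exact: bB|rewrite sw].
(* Both paths from [v i j], joined at their start, form the middle of the edge [ij]. By
   [reach_exchange], the sets of independent edges are disjoint. *)
pose U i j : {set V} :=
  [set u | (u \in v i j :: P i j i) || (u \in v i j :: P i j j)]%SET.
have UP i j u : u \in U i j -> exists2 k, k = i \/ k = j & u \in v i j :: P i j k.
  by rewrite finset.in_set => /orP[]; [exists i; auto|exists j; auto].
have PU i j k u : k = i \/ k = j -> u \in v i j :: P i j k -> u \in U i j.
  by move=> kij uP; rewrite finset.in_set; case: kij uP => -> ->; rewrite ?orbT.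
have UB i j u : i < 4 -> j < 4 -> u \in U i j -> u \notin B.
  move=> i4 j4 /UP[k kij]; have [[_ /allP aB _ _] _] := PP _ _ _ i4 j4 kij.
  exact: aB.
have bU i j k : i < 4 -> j < 4 -> k < 4 -> b k \notin U i j.
  by move=> i4 j4 k4; apply/negP => /(UB _ _ _ i4 j4); rewrite bB.
have wU i j k : k = i \/ k = j -> w i j k \in U i j.
  by move=> kij; apply: PU kij _; exact: mem_last.
have Udisj i j k l u : [/\ i < 4, j < 4, k < 4 & l < 4] -> uniq [:: i; j; k; l] ->
    u \in U i j -> u \notin U k l.
  move=> [i4 j4 k4 l4] u4 /UP[i' ii uP]; apply/negP => /UP[k' kk uP'].
  have [rp sp] := PP _ _ _ i4 j4 ii; have [rp' sp'] := PP _ _ _ k4 l4 kk.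
  have i'4 : i' < 4 by case: ii => ->.
  have k'4 : k' < 4 by case: kk => ->.
  move: u4; rewrite /= !seq.inE => u4.
  by case: (reach_exchange rp sp uP rp' sp' uP') => /reachE[] // kE; lia.
pose C : {set V} := [set u | connect h (b 0) u]%SET.
have CB : C \subset B.
  apply/fintype.subsetP => u; rewrite finset.in_set => /connectP[p].
  case/lastP: p => [_ ->|p y]; first exact: bB.
  rewrite rcons_path last_rcons => /andP[_ hy] ->.
  by apply: (hB (v := last (b 0) p)); rewrite h_sym.
pose Z i : plane := if i == 4 then pt (b 0) else q (b i) (x i).
pose S i j := if j == 4 then seg (pt (b i)) (q (b i) (x i)) `|` web h C
  else (tail (b i) (w i j i) (x i) `|` web e (U i j)) `|` tail (b j) (w i j j) (x j).
have webC : connected (web h C).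
  apply: (web_connected cd e_sym (u0 := b 0)) => //.
    by rewrite finset.in_set connect0.
  move=> u; rewrite finset.in_set => /connectP[p hp lp]; exists p; split=> //.
  by move=> y yp; rewrite finset.in_set; exact: (path_connect hp).
have webU i j : i < 4 -> j < 4 -> connected (web e (U i j)).
  move=> i4 j4; apply: (web_connected cd e_sym (u0 := v i j)) => //.
    by apply: (PU i j i); [left|exact: mem_head].
  move=> u /UP[k kij uk]; have [[ep _ _ _] _] := PP _ _ _ i4 j4 kij.
  have sub y : y \in v i j :: P i j k -> y \in U i j by exact: PU.
  case/splitPl: uk ep sub => p1 p2 lp; rewrite cat_path => /andP[ep _] sub.
  by exists p1; split=> // y yp; apply: sub; rewrite -cat_cons mem_cat yp.
apply: (@K5_sets R Z S).
- move=> i j /andP[ij j5]; rewrite /S /Z.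
  have i4 : i < 4 by lia.
  rewrite (ltn_eqF i4).
  have [ex _ _] := xP _ i4.
  have [j4|j4] := eqVneq j 4.
    have bC k : k < 4 -> star h (b k) `<=` web h C.
      by move=> k4; apply: star_web; rewrite finset.in_set b_conn.
    split.
    + by apply: compactU; [exact: seg_compact|exact: (web_compact cd)].
    + apply: connectedU; [|exact: seg_connected|exact: webC].
      exists (pt (b i)); split; first exact: seg_left.
      by apply: (bC _ i4); exact: star_pt.
    + by left; exact: seg_right.
    + by right; apply: (bC 0 isT); exact: star_pt.
  have {}j4 : j < 4 by lia.
  have oki := ok i j i i4 j4 (or_introl erefl); have okj := ok i j j i4 j4 (or_intror erefl).
  have cross k : k = i \/ k = j -> web e (U i j) (q (w i j k) (b k)).
    move=> kij; apply: (star_web (pt := pt) T (wU _ _ _ kij)).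
    apply: star_exit.
    by rewrite e_sym; have [] := wP _ _ _ i4 j4 kij.
  split.
  + apply: compactU; last exact: (tail_compact cd e_sym okj).
    by apply: compactU; [exact: (tail_compact cd e_sym oki)|exact: (web_compact cd)].
  + apply: connectedU; [|apply: connectedU|exact: (tail_connected cd e_sym okj)].
    * exists (q (w i j j) (b j)); split; first by right; apply: cross; right.
      exact: (tail_start cd e_sym okj).
    * exists (q (w i j i) (b i)); split; last by apply: cross; left.
      exact: (tail_start cd e_sym oki).
    * exact: (tail_connected cd e_sym oki).
    * exact: webU.
  + by left; left; exact: tail_end.
  + by right; exact: tail_end.
have main4 i j k : [/\ i < 4, j < 4 & k < 4] -> k != i -> k != j ->
    ((tail (b i) (w i j i) (x i) `|` web e (U i j)) `|` tail (b j) (w i j j) (x j))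
    `&` (seg (pt (b k)) (q (b k) (x k)) `|` web h C) = set0.
  move=> [i4 j4 k4] ki kj; have [ex xB sx] := xP _ k4.
  have oki := ok i j i i4 j4 (or_introl erefl); have okj := ok i j j i4 j4 (or_intror erefl).
  have secN l : l < 4 -> k != l -> b k = b l ->
      sec (b k) (q (b k) (x k)) <> sec (b l) (q (b l) (x l)).
    move=> l4 /eqP kl bkl; have [_ _ sl] := xP _ l4.
    by rewrite sx sl; apply: cells_distinct.
  have web_disj : web e (U i j) `&` web h C = set0.
    apply: (webs_disjoint cd) => // u uU.
    by apply: contra (UB _ _ _ i4 j4 uU); apply/fintype.subsetP.
  apply: disjoint_setUr; (apply: disjoint_setUl; [apply: disjoint_setUl|]).
  - exact: (ray_tail_disjoint cd e_sym e_irr h_sym he hB ex (bB k4) oki (secN _ i4 ki)).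
  - by apply: (ray_web_disjoint cd) => //; exact: bU.
  - exact: (ray_tail_disjoint cd e_sym e_irr h_sym he hB ex (bB k4) okj (secN _ j4 kj)).
  - exact: (tail_hweb cd e_sym e_irr h_sym he hB CB).
  - exact: web_disj.
  - exact: (tail_hweb cd e_sym e_irr h_sym he hB CB).
move=> i j k l /andP[ij j5] /andP[kl l5] u4; rewrite /S.
have i4 : i < 4 by lia.
have k4 : k < 4 by lia.
have [jE|j4] := eqVneq j 4; have [lE|l4] := eqVneq l 4.
- by exfalso; move: u4; rewrite jE lE /= !seq.inE eqxx !orbT /= andbF.
- rewrite setIC; apply: main4; first by split=> //; lia.
    by move: u4; rewrite /= !seq.inE; lia.
  by move: u4; rewrite /= !seq.inE; lia.
- apply: main4; first by split=> //; lia.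
    by move: u4; rewrite /= !seq.inE; lia.
  by move: u4; rewrite /= !seq.inE; lia.
have {}j4 : j < 4 by lia.
have {}l4 : l < 4 by lia.
have UU u : u \in U i j -> u \notin U k l by apply: Udisj.
have UU' u : u \in U k l -> u \notin U i j by apply: contraL; exact: UU.
have tt a c : a = i \/ a = j -> c = k \/ c = l ->
    tail (b a) (w i j a) (x a) `&` tail (b c) (w k l c) (x c) = set0.
  move=> aij ckl.
  have a4 : a < 4 by case: aij => ->.
  have c4 : c < 4 by case: ckl => ->.
  have ac : a <> c by move: u4; rewrite /= !seq.inE; case: aij ckl => -> [] ->; lia.
  apply: (tails_disjoint cd e_sym e_irr h_sym he hB); try exact: ok.
    by apply: contraTneq (wU _ _ _ ckl) => <-; apply: UU; exact: wU.
  have [_ _ ->] := xP _ a4; have [_ _ ->] := xP _ c4; exact: cells_distinct.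
have tw a : a = i \/ a = j -> tail (b a) (w i j a) (x a) `&` web e (U k l) = set0.
  move=> aij; have a4 : a < 4 by case: aij => ->.
  apply: (tail_web cd e_sym e_irr h_sym he hB) => //; first exact: ok.
    exact: bU.
  exact/UU/wU.
have wt c : c = k \/ c = l -> web e (U i j) `&` tail (b c) (w k l c) (x c) = set0.
  move=> ckl; have c4 : c < 4 by case: ckl => ->.
  rewrite setIC; apply: (tail_web cd e_sym e_irr h_sym he hB) => //; first exact: ok.
    exact: bU.
  exact/UU'/wU.
have ww : web e (U i j) `&` web e (U k l) = set0 by exact: (webs_disjoint cd).
apply: disjoint_setUr; [apply: disjoint_setUr|];
  (apply: disjoint_setUl; [apply: disjoint_setUl|]); rewrite ?ww //;
  first [by apply: tt; auto|by apply: tw; auto|by apply: wt; auto].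
Qed.
End Reach.

(** * Counting profiles *)

Section Counting.
Variable R : realType.
Notation plane := (R * R)%type.
Variables (V : finType) (e : rel V) (pt : V -> plane) (r : R)
  (q : V -> V -> plane) (T : V -> V -> set plane).
Hypotheses (cd : clean_drawing e pt r q T) (e_sym : symmetric e) (e_irr : irreflexive e).
Variables (h : rel V) (A B : {set V}) (d : nat).
Hypotheses (h_sym : symmetric h) (he : subrel h e) (hB : forall u v, h u v -> u \in B).
Hypotheses (AB : A \subset B)
  (hA : forall a a', a \in A -> a' \in A -> within e a a' (2 * d) -> connect h a a')
  (hBA : forall b a, b \in B -> a \in A -> within e b a d -> connect h b a).

Notation sec := (sec pt q h).
Notation reach := (reach e pt q h B).
Notation deg b := #|[set y | h b y]|.
Notation cell := (V * 'I_(#|V|.+2) * 'I_d.+1)%type.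

(* The condition on the distance from [s.1.1] to [A] forces the cells seen by one
   vertex into a single component of [h]. *)
Definition cells : {set cell} :=
  [set s : cell | [&& s.1.1 \in B, s.1.2 < (deg s.1.1).+2, 0 < s.2 &
     `[< exists2 a, a \in A & within e s.1.1 a (d - s.2) >]]].

Definition trace (v : V) : {set cell} :=
  [set s in cells | `[< reach v s.1.1 s.1.2 s.2 >]].

Lemma card_ord_lt n m : #|[set i : 'I_n | i < m]| <= m.
Proof.
rewrite cardE -(size_map val) -[X in _ <= X](size_iota 0); apply: uniq_leq_size.
  by rewrite map_inj_uniq ?enum_uniq //; exact: val_inj.
by move=> _ /mapP[i + ->]; rewrite mem_enum finset.inE mem_iota.
Qed.

(** The sector numbers at [b] run from 0 to [deg b + 1] and the distances from 1 to [d]; the degrees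
    add up to at most the number of ordered edges of [h]. *)
Lemma card_cells : #|cells| <= d * (#|[set x : V * V | h x.1 x.2]| + 2 * #|B|).
Proof.
pose Q b : {set cell} := finset.setX (finset.setX [set b] [set i | val i < (deg b).+2])
  [set~ ord0].
apply: (@leq_trans #|\bigcup_(b in B) Q b|).
  apply: subset_leq_card; apply/fintype.subsetP => -[[b n] k].
  rewrite finset.in_set => /and4P[/= bB nb k0 _]; apply/bigcupP; exists b => //.
  rewrite !finset.in_setX finset.in_set1 finset.in_set finset.in_setC1 /= eqxx nb /=.
  by rewrite -(inj_eq val_inj) /= -lt0n.
apply: leq_trans (card_bigcup_le _ _) _.
apply: (@leq_trans (\sum_(b in B) ((deg b).+2 * d))).
  apply: leq_sum => b _; rewrite !cardsX cards1 mul1n cardsC1 card_ord.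
  by rewrite leq_mul2r card_ord_lt orbT.
rewrite -big_distrl /= mulnC leq_mul2l; apply/orP; right.
under eq_bigr do rewrite -addn2.
rewrite big_split /= sum_nat_const mulnC [(2 * _)%N]mulnC leq_add2r.
apply: (@leq_trans (\sum_(b : V) deg b)); first by rewrite [leqRHS](bigID (mem B)) leq_addr.
rewrite (eq_bigr (fun b => \sum_(y | h b y) 1)); last first.
  by move=> b _; rewrite sum1dep_card.
by rewrite pair_big_dep /= sum1dep_card.
Qed.

Lemma reach_within v b n k : reach v b n k -> within e v b k.
Proof.
case=> p [ep _ eb _] pk; exists (rcons p b); rewrite last_rcons size_rcons; split=> //.
by rewrite rcons_path ep e_sym.
Qed.

Lemma trace_shatter (S : {set cell}) :
  shatters [set trace v | v in ~: B] S -> #|S| <= 3.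
Proof.
move=> /shattersP shS; rewrite leqNgt; apply/negP => S4.
have Scells s : s \in S -> s \in cells.
  have [_ /imsetP[v _ ->] <-] := shS S (subxx _).
  by rewrite finset.inE finset.in_set => /andP[/andP[]].
have [s0 s0S] : exists s, s \in S by apply/card_gt0P; apply: leq_trans S4.
pose s i := nth s0 (enum S) i.
have sS i : i < 4 -> s i \in S.
  by move=> i4; rewrite -mem_enum mem_nth // -cardE; apply: leq_trans S4.
have s_inj i j : i < 4 -> j < 4 -> s i = s j -> i = j.
  move=> i4 j4 /eqP; rewrite nth_uniq ?enum_uniq // -?cardE; first by move/eqP.
    exact: leq_trans S4.
  exact: leq_trans S4.
have pick (I : {set cell}) : I \subset S ->
    exists v, forall k, k < 4 -> reach v (s k).1.1 (s k).1.2 (s k).2 <-> s k \in I.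
  move=> /shS[_ /imsetP[v _ ->] <-]; exists v => k k4.
  rewrite finset.inE finset.in_set sS // Scells ?sS // andbT /=.
  by split=> [?|/asboolP//]; apply/asboolP.
have pair_pick (ij : nat * nat) : exists v, ij.1 < 4 -> ij.2 < 4 -> forall k, k < 4 ->
    reach v (s k).1.1 (s k).1.2 (s k).2 <-> k = ij.1 \/ k = ij.2.
  have [i4|n4] := boolP (ij.1 < 4); last by exists s0.1.1.
  have [j4|n4] := boolP (ij.2 < 4); last by exists s0.1.1.
  have [|v vP] := pick [set s ij.1; s ij.2].
    by apply/fintype.subsetP => x; rewrite finset.in_set2 => /orP[]/eqP->; exact: sS.
  exists v => _ _ k k4; rewrite vP // finset.in_set2; split.
    by case/orP=> /eqP/s_inj ->; auto.
  by case=> ->; rewrite eqxx ?orbT.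
have [v vP] := choice pair_pick.
(* A witness of [S] itself reaches all four cells, so the members of [A] near these cells are within
   [d] of [w], hence linked by [h]. *)
have [w wP] := pick S (subxx _).
have near i : i < 4 -> exists a, [/\ a \in A, connect h (s i).1.1 a & within e w a d].
  move=> i4; have := Scells _ (sS _ i4).
  rewrite finset.in_set => /and4P[biB _ k0 /asboolP[a aA wa]]; exists a.
  split=> //; first by apply: hBA => //; apply: within_le wa; rewrite leq_subr.
  have wk : within e w (s i).1.1 (s i).2 by apply: reach_within; apply/(wP _ i4)/sS.
  have := within_trans wk wa; rewrite subnKC // -ltnS; exact: ltn_ord.
apply: (@reach_false R V e pt r q T cd e_sym e_irr h B h_sym he hB (fun i => (s i).1.1)
  (fun i => val (s i).1.2) (fun i => val (s i).2) (fun i j => v (i, j))).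
- by move=> i i4; have := Scells _ (sS _ i4); rewrite finset.in_set => /andP[].
- by move=> i j k i4 j4 k4; exact: (vP (i, j)).
- move=> i i4; have [a [aA ca wa]] := near 0 isT; have [a' [aA' ca' wa']] := near i i4.
  apply: connect_trans ca _; rewrite (sym_connect_sym h_sym).
  apply: connect_trans ca' _; apply: hA => //; rewrite mul2n -addnn.
  exact: within_trans (within_sym e_sym wa') wa.
Qed.

Lemma first_hit v p : v \notin B -> path e v p -> last v p \in B ->
  exists p1 b p2, [/\ p = p1 ++ b :: p2, all [predC B] (v :: p1) & b \in B].
Proof.
elim: p v => [|x p IH] v vB /=; first by rewrite (negPf vB).
move=> /andP[vx xp] lp; have [xB|xB] := boolP (x \in B).
  by exists [::], x, p; rewrite /= vB.
have [p1 [b [p2 [-> ap1 bB]]]] := IH _ xB xp lp.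
by exists (x :: p1), b, p2; split; rewrite //= vB.
Qed.

(** Cut the walk at its first vertex [b] in [B]: [w] reaches [b] within the same number of steps and
    then follows the old walk. Equality of profiles uses this in both directions. *)
Lemma trace_within v w a t : v \notin B -> w \notin B -> trace v \subset trace w ->
  a \in A -> t <= d -> within e v a t -> within e w a t.
Proof.
move=> vB wB /fintype.subsetP vw aA td [p [ep lp sp]].
have aB : a \in B by apply: (fintype.subsetP AB).
have lB : last v p \in B by rewrite lp.
have [p1 [b [p2 [pE ap1 bB]]]] := first_hit vB ep lB.
move: ep lp sp; rewrite pE cat_path last_cat size_cat /= => /and3P[ep1 eb ep2] lp sp.
have rv : rpath e pt q h B v b (sec b (q b (last v p1))) p1 by split; rewrite // e_sym.
have k_lt : (size p1).+1 < d.+1.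
  by rewrite ltnS; apply: leq_trans td; apply: leq_trans sp; rewrite -addn1 leq_add.
have s_le := sector_le [set y | h b y] (dir pt q b) (q b (last v p1) - pt b)%R.
have n_lt : sec b (q b (last v p1)) < #|V|.+2.
  by rewrite ltnS; apply: leq_trans s_le _; rewrite ltnS max_card.
have wba : within e b a (size p2) by exists p2.
(* The distance is [(size p1).+1], since the step into [b] counts; hence it is positive. *)
pose s : cell := (b, Ordinal n_lt, Ordinal k_lt).
have : s \in trace v.
  rewrite !finset.in_set /= bB ltnS s_le /=; apply/andP; split; apply/asboolP.
    exists a => //; apply: within_le wba; rewrite leq_subRL; last by rewrite -ltnS.
    by apply: leq_trans td; apply: leq_trans sp; rewrite addnS addSn.
  by exists p1.
move=> /vw; rewrite finset.in_set => /andP[_ /asboolP /reach_within /= wk].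
by apply: within_le (within_trans wk wba); rewrite addSnnS.
Qed.

Lemma card_imset_factor (X Y Z : finType) (f : X -> Y) (g : X -> Z) (D : {set X}) :
  (forall x y, x \in D -> y \in D -> f x = f y -> g x = g y) ->
  #|[set g x | x in D]| <= #|[set f x | x in D]|.
Proof.
move=> fg; have [->|[x0 x0D]] := set_0Vmem D; first by rewrite !imset0 !cards0.
pose k y := g (odflt x0 [pick x in D | f x == y]).
have -> : [set g x | x in D] = [set k y | y in [set f x | x in D]].
  rewrite -imset_comp; apply: eq_in_imset => x xD; rewrite /k /=.
  by case: pickP => [y /andP[yD /eqP yx]|/(_ x)]; [apply: fg|rewrite xD eqxx].
exact: leq_imset_card.
Qed.

Lemma card_profiles :
  #|[set profile e d v A | v in [set: V]]| <= #|B| + (#|cells| ^ 3).+1.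
Proof.
have -> : [set: V] = B :|: ~: B by rewrite finset.setUCr.
rewrite imsetU; apply: leq_trans (leq_card_setU _ _) _.
apply: leq_add; first exact: leq_imset_card.
apply: (@leq_trans #|[set trace v | v in ~: B]|).
  apply: card_imset_factor => v w; rewrite !finset.in_setC => vB wB vw.
  apply: profile_eq => // a t aA td; split; apply: trace_within => //; by rewrite vw.
apply: shatter_bound; last exact: trace_shatter.
move=> _ /imsetP[v _ ->]; apply/fintype.subsetP => s.
by rewrite finset.in_set => /andP[].
Qed.
End Counting.

(** There are at most [2 * d * (4 * d + 1) * c] cells. The factor [c ^ 3] absorbs [c] and 1, leaving
    [8 * d ^ 3 * (4 * d + 1) ^ 3 + 2 * d + 2], which [64 * (d + 2) ^ 7] dominates coefficient by
    coefficient. *)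
Lemma profile_bound d c : 0 < c ->
  (2 * d).+1 * c + ((d * (4 * d * c + 2 * ((2 * d).+1 * c))) ^ 3).+1
  <= 64 * c ^ 3 * (d + 2) ^ 7.
Proof.
move=> c0.
have cc : c <= c ^ 3 by rewrite expnS leq_pmulr // expn_gt0 c0.
have c1 : 0 < c ^ 3 by rewrite expn_gt0 c0.
have -> : d * (4 * d * c + 2 * ((2 * d).+1 * c)) = 2 * (d * ((4 * d + 1) * c)) by nia.
rewrite !expnMn; set D := d ^ 3; set E := (4 * d + 1) ^ 3.
apply: (@leq_trans (((2 * d).+2 + 8 * (D * E)) * c ^ 3)); first nia.
rewrite mulnAC leq_mul2r; apply/orP; right.
rewrite /D /E !expnS !expn0; nia.
Qed.

Theorem theorem4p1 (R : realType) (V : finType) (e : rel V)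
    (e_sym : symmetric e) (e_irr : irreflexive e) (e_planar : planar R e)
    (d c : nat) (d_ge1 : (1 <= d)%N)
    (A : {set V}) (A_neq0 : A != finset.set0) (c_ge1 : (1 <= c)%N)
    (A_card : #|A| = c) :
  (#|[set profile e d v A | v in [set: V]]%SET| <= 64 * c ^ 3 * (d + 2) ^ 7)%N.
Proof.
have [pt [r [q [T cd]]]] := planar_clean e_sym e_irr e_planar.
have [h [B [h_sym he AB hB [hE cB hA hBA]]]] := links e_sym A d.
apply: leq_trans (card_profiles cd e_sym e_irr h_sym he hB AB hA hBA) _.
rewrite A_card in hE cB.
apply: leq_trans _ (profile_bound d c_ge1).
apply: leq_add => //; rewrite ltnS leq_exp2r //.
apply: leq_trans (card_cells e h A B d) _.
by rewrite leq_mul2l leq_add ?orbT // leq_mul2l cB.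
Qed.
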